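(* Consider the two-timescale delay-optimal control problem $\min_\pi J_\pi^{(\boldsymbol\beta,\boldsymbol\gamma)}(\boldsymbol\chi(1))$ over feasible policies $\pi=\{\Omega^1,\Omega^2,\dots\}$, $\Omega^t=(\Omega_p^{E,t},\Omega_p^{G,t},\Omega_s^t)$, as defined in the context. Let the BS-DTX control for slot $t$ be denoted by $\Omega_p^t:\boldsymbol{\mathcal E}\times\boldsymbol{\mathcal Q}\to\boldsymbol{\mathcal P}$, a mapping from the partial system state $(\mathbf E(t),\mathbf Q(t))$ to the BS-DTX action $\Omega_p^t(\mathbf E(t),\mathbf Q(t))=\mathbf p(t)$, where $p_b(t)=p_b^E(t)+p_b^G(t)$; write $\Omega_{p,b}^t,\Omega_{p,b}^{E,t},\Omega_{p,b}^{G,t}$ for the $b$-th components. Conditioned on any $\Omega_{p,b}^t$, the optimal $\Omega_{p,b}^{E,t}$ and $\Omega_{p,b}^{G,t}$ satisfy $$\Omega_{p,b}^{E,t}(\mathbf E(t),\mathbf Q(t))=\Omega_{p,b}^{t}(\mathbf E(t),\mathbf Q(t))\,\mathbf I[E_b(t)>0],\qquad \Omega_{p,b}^{G,t}(\mathbf E(t),\mathbf Q(t))=\Omega_{p,b}^{t}(\mathbf E(t),\mathbf Q(t))\,\mathbf I[E_b(t)=0]$$ for all $b\in\mathcal B$ and all $t$.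
   Context: **System.** There are $B$ base stations (BSs), each with $N_t$ antennas, and $K$ single-antenna mobile stations (MSs). $\mathcal B=\{1,\dots,B\}$ is partitioned into $N=B/N_t$ clusters $\mathcal B_1,\dots,\mathcal B_N$ of $N_t$ BSs each. The set $\mathcal K$ of MSs is the disjoint union of the sets $\mathcal K_b$ (MSs associated with BS $b$). Time is slotted, $t=1,2,\dots$. The fading vector from BS $b$ to MS $k$ in slot $t$ is $\mathbf h_{k,b}(t)\in\mathcal H$, a finite subset of $\mathbb C^{N_t}$; its entries have mean 0 and variance 1, it is i.i.d. over $t$ and independent over $(k,b)$. Path gains $L_{k,b}$ and transmit powers $P_b$ are constants. The channel state information (CSI) is $\mathbf H=\{\mathbf h_{k,b}:k\in\mathcal K_b,b\in\mathcal B\}\in\boldsymbol{\mathcal H}$. BS-DTX (discontinuous transmission) actions are $\mathbf p=(p_b)_{b}\in\boldsymbol{\mathcal P}\subseteq\{0,1\}^B$ and user scheduling actions are $\mathbf s=(s_k)_k\in\boldsymbol{\mathcal S}\subseteq\{0,1\}^K$. For $k\in\mathcal K_b$, $b\in\mathcal B_n$, the SINR is $\rho_k=P_k^{rx}/(N_0+I_k)$, with $P_k^{rx}=p_bP_bL_{k,b}\|\mathbf h_{k,b}^T\mathbf w_{k,b}\|^2s_k$ and $I_k=\sum_{n'\ne n}\sum_{b'\in\mathcal B_{n'}}p_{b'}P_{b'}L_{k,b'}\|\mathbf h_{k,b'}^T(\sum_{k'\in\mathcal K_{b'}}\mathbf w_{k',b'}s_{k'})\|^2$, where $N_0>0$ and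 the zero-forcing beamformers $\mathbf w_{k,b}$ solve $\sum_{k\in\mathcal K_b}\|\mathbf w_{k,b}\|^2s_k=p_b$ and $s_k\mathbf h_{k,b'}^T(\sum_{k'\in\mathcal K_{b'}}\mathbf w_{k',b'}s_{k'})=0$ for all $b'\in\mathcal B_n$, $b'\ne b$ (if several solutions, the one maximizing $\|\mathbf h_{k,b}^T\mathbf w_{k,b}\|^2$). One packet of MS $k$ is received in a slot iff $\rho_k\ge\delta_k$; there exists $(\mathbf H,\mathbf p,\mathbf s)$ with $\Pr[\rho_k(\mathbf H,\mathbf p,\mathbf s)\ge\delta_k]>0$. **Queues.** Data arrivals $A^Q_k(t)$ and renewable energy arrivals $A^E_b(t)$ are nonnegative-integer valued, i.i.d. over $t$, independent over $k$ and $b$, with means $\lambda_k^Q<1$, $\lambda_b^E<1$. With $x^+=\max\{x,0\}$ and $\mathbf I[\cdot]$ the indicator, the data queues $Q_k\in\{0,\dots,N_Q\}$ and energy queues $E_b\in\{0,\dots,N_E\}$ evolve by $Q_k(t+1)=\min\{[Q_k(t)-\mathbf I[\rho_k(t)\ge\delta_k]]^++A^Q_k(t),N_Q\}$, $E_b(t+1)=\min\{[E_b(t)-p_b^E(t)]^++A^E_b(t),N_E\}$. $\mathbf Q=(Q_k)\in\boldsymbol{\mathcal Q}=\{0,\dots,N_Q\}^K$, $\mathbf E=(E_b)\in\boldsymbol{\mathcal E}=\{0,\dots,N_E\}^B$, and the global state is $\boldsymbol\chi=(\mathbf E,\mathbf Q,\mathbf H)$. **Policies.** A policy is $\pi=\{\Omega^1,\Omega^2,\dots\}$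 with $\Omega^t=(\Omega_p^{E,t},\Omega_p^{G,t},\Omega_s^t)$, where $\Omega_p^{E,t}(\mathbf E(t),\mathbf Q(t))=\mathbf p^E(t)\in\boldsymbol{\mathcal P}$ (renewable power action), $\Omega_p^{G,t}(\mathbf E(t),\mathbf Q(t))=\mathbf p^G(t)\in\boldsymbol{\mathcal P}$ (grid power action), $\Omega_s^t(\boldsymbol\chi(t))=\mathbf s(t)\in\boldsymbol{\mathcal S}$. It is feasible if for all $t$ and $b$: $p_b^E(t)=0$ whenever $E_b(t)=0$; $p_b(t)=p_b^E(t)+p_b^G(t)\in\{0,1\}$; and $\sum_{k\in\mathcal K_b}s_k(t)=p_b(t)$. **Problem.** For constants $\beta_k>0$, $\gamma_b>0$ and a monotonically increasing function $f$, minimize over feasible $\pi$ $$J_\pi^{(\boldsymbol\beta,\boldsymbol\gamma)}(\boldsymbol\chi(1))=\sum_k\beta_k\limsup_{T\to\infty}\tfrac1T\mathbb E^\pi\Big[\sum_{t=1}^Tf(Q_k(t))\Big]+\sum_b\gamma_b\limsup_{T\to\infty}\tfrac1T\mathbb E^\pi\Big[\sum_{t=1}^Tp_b^G(t)\Big].$$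
   Formalization: Conditioning on all mappings Ω_p^t is false; instead either the action processes p(t), s(t) are fixed, or the mappings Ω_p^t in finitely many initial slots; P is assumed closed under switching BSs off; ''the optimal satisfy'' means some optimal solution does. *)

(* Defs.v *)
From HB Require Import structures.
From mathcomp Require Import all_boot all_order all_algebra.
From mathcomp Require Import complex.
From mathcomp Require Import all_classical all_reals all_analysis.

Set Implicit Arguments.
Unset Strict Implicit.
Unset Printing Implicit Defensive.

Import Order.TTheory GRing.Theory Num.Theory.
Import numFieldNormedType.Exports.

Local Open Scope classical_set_scope.
Local Open Scope ring_scope.

Section Beamforming.
Context {R : realType} {B K N Nt : nat}.
Variables (assoc : 'I_K -> 'I_B) (cluster : 'I_B -> 'I_N).

Definition sqmod (z : complex R) : R := complex.Re z ^+ 2 + complex.Im z ^+ 2.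

Definition sqnorm (v : 'cV[complex R]_Nt) : R := \sum_i sqmod (v i ord0).

(* The bilinear (not sesquilinear) product h^T w. *)
Definition dotT (h w : 'cV[complex R]_Nt) : complex R := (h^T *m w) ord0 ord0.

(* [h k b] is the fading vector from BS b to MS k; [w k] is the beamformer of
   MS k at its own BS [assoc k]. *)
Implicit Types (h : 'I_K -> 'I_B -> 'cV[complex R]_Nt).
Implicit Types (w : 'I_K -> 'cV[complex R]_Nt).
Implicit Types (p : {ffun 'I_B -> bool}) (s : {ffun 'I_K -> bool}).

Definition admissible p s : Prop :=
  forall b, (\sum_(k | assoc k == b) s k)%N = p b.

Definition bs_beam s w (b : 'I_B) : 'cV[complex R]_Nt :=
  \sum_(k | assoc k == b) (s k)%:R *: w k.

Definition zf_solution h p s w : Prop :=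
  (forall b, \sum_(k | assoc k == b) sqnorm (w k) * (s k)%:R = (p b)%:R) /\
  (forall k b', cluster b' = cluster (assoc k) -> b' != assoc k ->
     (s k)%:R * dotT (h k b') (bs_beam s w b') = 0).

Definition zf_beamformer h p s w : Prop :=
  zf_solution h p s w /\
  forall w', zf_solution h p s w' -> forall k, s k ->
    sqmod (dotT (h k (assoc k)) (w' k)) <= sqmod (dotT (h k (assoc k)) (w k)).

End Beamforming.

(* The constants of the system.  The sets K_b are the fibres of [assoc] and the
   clusters B_n are the fibres of [cluster]; [cluster_card] forces nBS = nCl * nAnt. *)
Record network (R : realType) := Network {
  nBS : nat;
  nMS : nat;
  nCl : nat;
  nAnt : nat;
  assoc : 'I_nMS -> 'I_nBS;
  cluster : 'I_nBS -> 'I_nCl;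
  cluster_card : forall n : 'I_nCl, #|[set b | cluster b == n]%SET| = nAnt;
  (* the finite set of values of the fading vectors *)
  fadings : seq 'cV[complex R]_nAnt;
  gain : 'I_nMS -> 'I_nBS -> R;
  power : 'I_nBS -> R;
  noise_power : R;
  noise_power_gt0 : 0 < noise_power;
  threshold : 'I_nMS -> R;
  dtx_set : {set {ffun 'I_nBS -> bool}};
  sched_set : {set {ffun 'I_nMS -> bool}};
  NQ : nat;
  NE : nat;
  (* a selection of zero-forcing beamformers; several maximizers may exist.
     For admissible (p, s) at least one does, each BS serving at most one MS
     and facing at most nAnt - 1 linear constraints *)
  bf : ('I_nMS -> 'I_nBS -> 'cV[complex R]_nAnt) -> {ffun 'I_nBS -> bool} ->
       {ffun 'I_nMS -> bool} -> 'I_nMS -> 'cV[complex R]_nAnt;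
  bf_zf : forall h p s, admissible assoc p s ->
       zf_beamformer assoc cluster h p s (bf h p s);
  cost : nat -> R;
  cost_mono : {homo cost : x y / (x <= y)%N >-> x <= y};
  beta : 'I_nMS -> R;
  beta_gt0 : forall k, 0 < beta k;
  gamma : 'I_nBS -> R;
  gamma_gt0 : forall b, 0 < gamma b }.

Section Model.
Context {R : realType} (M : network R).

Definition fval := seq_sub (fadings M).
Definition channel := 'I_(nMS M) -> 'I_(nBS M) -> 'cV[complex R]_(nAnt M).
Definition csi := {ffun 'I_(nMS M) -> fval}.
Definition bs_act := {ffun 'I_(nBS M) -> bool}.
Definition ms_act := {ffun 'I_(nMS M) -> bool}.
Definition energy := {ffun 'I_(nBS M) -> 'I_(NE M).+1}.
Definition queues := {ffun 'I_(nMS M) -> 'I_(NQ M).+1}.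

Record state := State { st_E : energy; st_Q : queues; st_H : csi }.

Definition rx_power (h : channel) (p : bs_act) (s : ms_act) k : R :=
  let b := assoc k in
  (p b)%:R * power b * gain k b * sqmod (dotT (h k b) (bf h p s k)) * (s k)%:R.

Definition interference (h : channel) (p : bs_act) (s : ms_act) k : R :=
  \sum_(b' | cluster b' != cluster (assoc k))
    (p b')%:R * power b' * gain k b' *
    sqmod (dotT (h k b') (bs_beam (@assoc R M) s (bf h p s) b')).

Definition sinr (h : channel) (p : bs_act) (s : ms_act) k : R :=
  rx_power h p s k / (noise_power M + interference h p s k).

(* [x - y] on nat is truncated, i.e. [x - y]^+. *)
Definition next_energy (e : energy) (pE : bs_act) (a : 'I_(nBS M) -> nat) : energy :=
  [ffun b => inord (minn (e b - pE b + a b) (NE M))].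

Definition next_queues (q : queues) (h : channel) (p : bs_act) (s : ms_act)
    (a : 'I_(nMS M) -> nat) : queues :=
  [ffun k => inord (minn (q k - (threshold k <= sinr h p s k)%R + a k) (NQ M))].

(* [dtx pE pG b] is the sum pE_b + pG_b whenever that sum is at most 1. *)
Definition dtx (pE pG : bs_act) : bs_act := [ffun b => pE b || pG b].

Definition feasible_action (e : energy) (pE pG : bs_act) (s : ms_act) : Prop :=
  [/\ [/\ pE \in dtx_set M, pG \in dtx_set M, dtx pE pG \in dtx_set M &
          s \in sched_set M],
      forall b, e b = 0%N :> nat -> pE b = false,
      forall b, (pE b + pG b <= 1)%N &
      admissible (@assoc R M) (dtx pE pG) s].

Definition greedy_split (e : energy) (pE pG : bs_act) : Prop :=
  forall b, pE b = dtx pE pG b && (0 < e b)%N /\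
            pG b = dtx pE pG b && (e b == 0%N :> nat).

(* Slots are numbered from 0: slot t here is the (t+1)-st slot. *)
Record policy := Policy {
  renew : nat -> energy -> queues -> bs_act;
  grid : nat -> energy -> queues -> bs_act;
  sched : nat -> energy -> queues -> csi -> ms_act }.

Definition policy_dtx (pi : policy) t (e : energy) (q : queues) : bs_act :=
  dtx (renew pi t e q) (grid pi t e q).

Definition feasible (pi : policy) : Prop :=
  forall t e q H,
    feasible_action e (renew pi t e q) (grid pi t e q) (sched pi t e q H).

Definition greedy (pi : policy) : Prop :=
  forall t e q, greedy_split e (renew pi t e q) (grid pi t e q).

End Model.

Definition mutually_independent d (T : measurableType d) (R : realType)
    (P : probability T R) (I : eqType) (F : I -> set (set T)) : Prop :=
  forall (r : seq I) (A : I -> set T), uniq r ->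
    (forall i, i \in r -> F i (A i)) ->
    P (\big[setI/setT]_(i <- r) A i) = (\prod_(i <- r) P (A i))%E.

Definition events_of {T V : Type} (X : T -> V) : set (set T) :=
  [set X @^-1` A | A in setT].

(* The exogenous processes of a network.  [seq_sub (fadings M)] and nat are
   discrete, so measurability and laws are given on points. *)
Record exogenous (R : realType) (M : network R) d (T : measurableType d)
    (P : probability T R) := Exogenous {
  fad : nat -> 'I_(nMS M) -> 'I_(nBS M) -> T -> fval M;
  AQ : nat -> 'I_(nMS M) -> T -> nat;
  AE : nat -> 'I_(nBS M) -> T -> nat;
  lamQ : 'I_(nMS M) -> R;
  lamE : 'I_(nBS M) -> R;
  fad_meas : forall t k b v, measurable (fad t k b @^-1` [set v]);
  AQ_meas : forall t k n, measurable (AQ t k @^-1` [set n]);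
  AE_meas : forall t b n, measurable (AE t b @^-1` [set n]);
  fad_ident : forall t k b v,
    P (fad t k b @^-1` [set v]) = P (fad 0%N k b @^-1` [set v]);
  AQ_ident : forall t k n,
    P (AQ t k @^-1` [set n]) = P (AQ 0%N k @^-1` [set n]);
  AE_ident : forall t b n,
    P (AE t b @^-1` [set n]) = P (AE 0%N b @^-1` [set n]);
  exo_indep : mutually_independent P
    (fun i : nat * 'I_(nMS M) * 'I_(nBS M) + nat * 'I_(nMS M) + nat * 'I_(nBS M) =>
       match i with
       | inl (inl (t, k, b)) => events_of (fad t k b)
       | inl (inr (t, k)) => events_of (AQ t k)
       | inr (t, b) => events_of (AE t b)
       end);
  fad_mean : forall t k b i,
    (\int[P]_w (complex.Re (ssval (fad t k b w) i ord0))%:E = 0)%E /\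
    (\int[P]_w (complex.Im (ssval (fad t k b w) i ord0))%:E = 0)%E;
  fad_var : forall t k b i,
    (\int[P]_w (sqmod (ssval (fad t k b w) i ord0))%:E = 1)%E;
  AQ_mean : forall t k, (\int[P]_w ((AQ t k w)%:R)%:E = (lamQ k)%:E)%E;
  AE_mean : forall t b, (\int[P]_w ((AE t b w)%:R)%:E = (lamE b)%:E)%E;
  lamQ_lt1 : forall k, lamQ k < 1;
  lamE_lt1 : forall b, lamE b < 1;
  (* Given the CSI H, the SINR is still random through the cross links; the
     joint event below has positive probability iff P(H) > 0 and the conditional
     probability given H is positive.  The SINR is meaningful only for
     admissible (p, s), on which the beamformers are specified. *)
  servable : forall k, exists (H : csi M) (p : bs_act M) (s : ms_act M),
    [/\ p \in dtx_set M, s \in sched_set M, admissible (@assoc R M) p s &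
      (0 < P [set w | (forall k', fad 0%N k' (assoc k') w = H k') /\
                      (threshold k <= sinr (fun k' b => ssval (fad 0%N k' b w))
                                           p s k)%R])%E] }.

Section Dynamics.
Context {R : realType} {M : network R} {d : measure_display}
  {T : measurableType d} {P : probability T R} (X : exogenous M P).

(* The CSI of the first slot is the one of the given initial state; all other
   fading vectors are random. *)
Definition fad_at (chi1 : state M) t (w : T) k b : fval M :=
  if (t == 0%N) && (b == assoc k) then st_H chi1 k else fad X t k b w.

Definition channel_at chi1 t w : channel M := fun k b => ssval (fad_at chi1 t w k b).

Definition csi_at chi1 t w : csi M := [ffun k => fad_at chi1 t w k (assoc k)].

(* The actions taken in each slot, as random processes.  Renewable power use
   moves the energy state at which the mappings of a policy are evaluated, so
   two policies with the same DTX mappings and different splits generally have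
   different DTX action processes; controls allow the action process itself to
   be held fixed.  Nonanticipation is not required of a control. *)
Record control := Control {
  c_renew : nat -> T -> bs_act M;
  c_grid : nat -> T -> bs_act M;
  c_sched : nat -> T -> ms_act M }.

Definition c_dtx (c : control) t w : bs_act M := dtx (c_renew c t w) (c_grid c t w).

Definition step chi1 t w (x : energy M * queues M) (pE pG : bs_act M) (s : ms_act M)
    : energy M * queues M :=
  (next_energy x.1 pE (fun b => AE X t b w),
   next_queues x.2 (channel_at chi1 t w) (dtx pE pG) s (fun k => AQ X t k w)).

Fixpoint traj chi1 (c : control) t w : energy M * queues M :=
  if t is t'.+1 then
    step chi1 t' w (traj chi1 c t' w) (c_renew c t' w) (c_grid c t' w) (c_sched c t' w)
  else (st_E chi1, st_Q chi1).

Fixpoint policy_traj chi1 (pi : policy M) t w : energy M * queues M :=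
  if t is t'.+1 then
    let x := policy_traj chi1 pi t' w in
    step chi1 t' w x (renew pi t' x.1 x.2) (grid pi t' x.1 x.2)
      (sched pi t' x.1 x.2 (csi_at chi1 t' w))
  else (st_E chi1, st_Q chi1).

Definition closed_loop chi1 (pi : policy M) : control :=
  let x := policy_traj chi1 pi in
  Control (fun t w => renew pi t (x t w).1 (x t w).2)
          (fun t w => grid pi t (x t w).1 (x t w).2)
          (fun t w => sched pi t (x t w).1 (x t w).2 (csi_at chi1 t w)).

Definition feasible_control chi1 (c : control) : Prop :=
  (forall t,
     [/\ forall a, measurable (c_renew c t @^-1` [set a]),
         forall a, measurable (c_grid c t @^-1` [set a]) &
         forall a, measurable (c_sched c t @^-1` [set a])]) /\
  (forall t w, feasible_action (traj chi1 c t w).1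
                 (c_renew c t w) (c_grid c t w) (c_sched c t w)).

(* Greedy along the energy trajectory that the control itself produces. *)
Definition greedy_control chi1 (c : control) : Prop :=
  forall t w, greedy_split (traj chi1 c t w).1 (c_renew c t w) (c_grid c t w).

Definition same_dtx_sched (c c' : control) : Prop :=
  forall t w, c_dtx c t w = c_dtx c' t w /\ c_sched c t w = c_sched c' t w.

Definition limsup_avg (g : nat -> T -> R) : \bar R :=
  limn_esup (fun n => ((n%:R^-1)%:E * \int[P]_w (\sum_(t < n) g t w)%:E)%E).

Definition control_J chi1 (c : control) : \bar R :=
  (\sum_k (beta k)%:E * limsup_avg (fun t w => cost M ((traj chi1 c t w).2 k)) +
   \sum_b (gamma b)%:E * limsup_avg (fun t w => (c_grid c t w b)%:R))%E.

Definition J chi1 (pi : policy M) : \bar R := control_J chi1 (closed_loop chi1 pi).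

End Dynamics.

(* Main.v *)
(** Part one is pathwise: with the DTX and scheduling actions held fixed, a unit of
    renewable energy that a greedy control spends early is one unit of grid energy
    less so far, so at every time its cumulative grid use is minimal.

    Part two is an average-cost decision problem on the finite state space of energy
    and data queues.  Restrict to greedy actions and let [V] be an optimal discounted
    value.  One unit of stored energy is worth at most [gamma b], so [V] obeys the
    Bellman inequality for all feasible actions, greedy or not.  Mean arrivals below 1
    make the empty data queues reachable, which bounds the oscillation of [V] uniformly
    in the discount factor.  A stationary policy that is discount optimal for factors
    tending to 1 therefore has a constant gain [g], no feasible policy costs less than
    [g], and the first [n] slots, being transient, are irrelevant. *)

(* Part two cannot be settled pathwise: the split moves the energy state at which the DTX mappings
   are evaluated. Moreover the objective is a weighted sum of separate limits superior. For the
   upper bound each cost component therefore gets its own Poisson equation. Its gain [u i] may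
   depend on the state; only the weighted sum of the gains is constant, and bounded bias terms make
   the average of every component converge. For the lower bound, a sum of limits superior dominates
   the limit superior of the sum. The Poisson equation is obtained by linear algebra on a
   finite-dimensional space, so neither stationary distributions nor recurrence classes appear.

   Slot 0 is exceptional. Its CSI is given, so the law of a slot has its general form only from slot
   1 on, and all estimates start there. Arrivals are truncated at the buffer sizes; this leaves the
   dynamics unchanged and makes the noise of a slot finite. *)
Require Import Defs.
From HB Require Import structures.
From mathcomp Require Import all_boot all_order all_algebra complex.
From mathcomp Require Import all_classical all_reals all_analysis measurable_realfun.
From mathcomp Require Import zify ring lra.

Set Implicit Arguments.
Unset Strict Implicit.
Unset Printing Implicit Defensive.

Import Order.TTheory GRing.Theory Num.Theory.
Import numFieldNormedType.Exports.
Local Open Scope classical_set_scope.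
Local Open Scope ring_scope.

(** * Finite averages and the Poisson equation *)

Section Mean.
Context {R : realType} {Y : finType} (mu : Y -> R).

Definition mean (f : Y -> R) : R := \sum_y mu y * f y.

Lemma meanD f g : mean (fun y => f y + g y) = mean f + mean g.
Proof. by rewrite -big_split; apply: eq_bigr => y _; rewrite mulrDr. Qed.

Lemma meanZ a f : mean (fun y => a * f y) = a * mean f.
Proof. by rewrite mulr_sumr; apply: eq_bigr => y _; rewrite mulrCA. Qed.

Lemma meanB f g : mean (fun y => f y - g y) = mean f - mean g.
Proof.
by rewrite -sumrB; apply: eq_bigr => y _; rewrite mulrBr.
Qed.

Lemma eq_mean f g : f =1 g -> mean f = mean g.
Proof. by move=> fg; apply: eq_bigr => y _; rewrite fg. Qed.

Hypotheses (mu_ge0 : forall y, 0 <= mu y) (mu_sum1 : \sum_y mu y = 1).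

Lemma mean_cst a : mean (fun=> a) = a.
Proof. by rewrite /mean -mulr_suml mu_sum1 mul1r. Qed.

Lemma le_mean f g : (forall y, f y <= g y) -> mean f <= mean g.
Proof. by move=> fg; apply: ler_sum => y _; rewrite ler_wpM2l. Qed.

Lemma mean_le f b : (forall y, f y <= b) -> mean f <= b.
Proof. by move=> fb; rewrite -[leRHS]mean_cst le_mean. Qed.

Lemma mean_ge f b : (forall y, b <= f y) -> b <= mean f.
Proof. by move=> fb; rewrite -[leLHS]mean_cst le_mean. Qed.

Lemma mean_norm_le f b : (forall y, `|f y| <= b) -> `|mean f| <= b.
Proof.
move=> fb; rewrite ler_norml mean_le ?mean_ge// => y.
  by have := fb y; rewrite ler_norml => /andP[].
by have := fb y; rewrite ler_norml => /andP[].
Qed.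

Lemma le_atom1 y : mu y <= 1.
Proof.
by rewrite -mu_sum1 (bigD1 y)//= lerDl sumr_ge0.
Qed.

Lemma mean_le_atom y f b : (forall z, f z <= b) ->
  mean f <= mu y * f y + (1 - mu y) * b.
Proof.
move=> fb; have -> : 1 - mu y = \sum_(z | z != y) mu z.
  by apply/eqP; rewrite subr_eq -mu_sum1 (bigD1 y)//= addrC.
rewrite /mean (bigD1 y)//= lerD2l.
by rewrite mulr_suml ler_sum// => z _; rewrite ler_wpM2l.
Qed.

(** At a maximizer of [D] on the invariant set [Q] the average is at most [D] itself, and [a < 1]
    leaves [D <= b]. The predicate [Q] allows pairs of states to be compared under an ordering. *)
Lemma maximum_principle (I : finType) (Q : pred I) (F : I -> Y -> I)
    (a b : R) (D : I -> R) : 0 <= a -> a < 1 ->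
  (forall i y, Q i -> Q (F i y)) ->
  (forall i, Q i -> D i <= a * mean (D \o F i) + (1 - a) * b) ->
  forall i, Q i -> D i <= b.
Proof.
move=> a0 a1 QF hD i Qi.
case: (arg_maxP D Qi) => m Qm maxm; apply: (le_trans (maxm i Qi)).
have le1 : mean (D \o F m) <= D m by apply: mean_le => y; exact/maxm/QF.
have := hD m Qm; have := ler_wpM2l a0 le1; nra.
Qed.

Lemma discounted_bound (S : finType) (F : S -> Y -> S) (a B : R) (c V : S -> R) :
  0 <= a -> a < 1 -> (forall x, `|c x| <= B) ->
  (forall x, V x = c x + a * mean (V \o F x)) ->
  forall x, (1 - a) * `|V x| <= B.
Proof.
move=> a0 a1 cB VE x.
have a1' : 0 < 1 - a by rewrite subr_gt0.
have cB' y : - B <= c y /\ c y <= B.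
  by have := cB y; rewrite ler_norml => /andP[].
rewrite mulrC -ler_pdivlMr// ler_norml; apply/andP; split.
  rewrite lerNl.
  apply: (@maximum_principle S predT F a _ (fun x => - V x)) => // y _.
  have -> : mean ((fun x => - V x) \o F y) = - mean (V \o F y).
    by rewrite -mulN1r -meanZ; apply: eq_mean => z /=; rewrite mulN1r.
  rewrite mulrCA divff ?mulr1 ?gt_eqF//.
  have := VE y; have [] := cB' y; lra.
apply: (@maximum_principle S predT F a _ V) => // y _.
rewrite mulrCA divff ?mulr1 ?gt_eqF//.
have := VE y; have [] := cB' y; lra.
Qed.

End Mean.

Section Resolvent.
Context {R : realType} {S Y : finType} (mu : Y -> R) (F : S -> Y -> S) (a : R).

(** The operator [1 - a K], with [K] the averaging operator of the chain. Values in [R^o] make the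
    functions on [S] a finite-dimensional vector space. *)
Definition resolvent (v : {ffun S -> R^o}) : {ffun S -> R^o} :=
  [ffun x => v x - a * mean mu (v \o F x)].

Fact resolvent_is_linear : linear resolvent.
Proof.
move=> k u v; apply/ffunP => x; rewrite !ffunE /=.
have -> : mean mu ((k *: u + v : {ffun S -> R^o}) \o F x) =
    k * mean mu (u \o F x) + mean mu (v \o F x).
  by rewrite -meanZ -meanD; apply: eq_mean => y /=; rewrite !ffunE.
by rewrite /GRing.scale /=; ring.
Qed.

HB.instance Definition _ := GRing.isLinear.Build R _ _ _ resolvent resolvent_is_linear.

Hypotheses (mu_ge0 : forall y, 0 <= mu y) (mu_sum1 : \sum_y mu y = 1).

(** A kernel element of the resolvent is a discounted value for zero cost, hence zero by
    [discounted_bound]. An injective endomorphism in finite dimension is invertible. *)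
Lemma discounted_value (c : S -> R) : 0 <= a -> a < 1 ->
  exists V : S -> R, forall x, V x = c x + a * mean mu (V \o F x).
Proof.
move=> a0 a1.
have inj : lker (linfun resolvent) == 0%VS.
  apply/eqP/vspaceP => v; rewrite memv0 memv_ker lfunE /=.
  apply/eqP/eqP => [/ffunP Rv0|->]; last by rewrite linear0.
  apply/ffunP => x; rewrite ffunE.
  have VE y : v y = 0 + a * mean mu (v \o F y).
    by have := Rv0 y; rewrite !ffunE add0r => /subr0_eq.
  have n0 (y : S) : `|0 : R| <= 0 by rewrite normr0.
  have := discounted_bound mu_ge0 mu_sum1 a0 a1 n0 VE x.
  rewrite pmulr_rle0 ?subr_gt0// normr_le0 => /eqP ->//.
pose W := (linfun resolvent)^-1%VF [ffun x => c x].
exists W => x.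
have : resolvent W x = c x.
  by have /ffunP/(_ x) := lker0_lfunVK inj [ffun x => c x]; rewrite lfunE /= => ->; rewrite ffunE.
by rewrite !ffunE => <-; rewrite subrK.
Qed.

End Resolvent.

Section Poisson.
Context {R : realType} {S Y : finType} (mu : Y -> R) (F : S -> Y -> S).
Hypotheses (mu_ge0 : forall y, 0 <= mu y) (mu_sum1 : \sum_y mu y = 1).

Lemma eq0_of_natmul_bounded (w B : R) : (forall m : nat, m%:R * `|w| <= B) -> w = 0.
Proof.
move=> hB; apply/eqP; apply/negP => /negP w0.
have w_gt0 : 0 < `|w| by rewrite normr_gt0.
have := hB (Num.truncn (B / `|w|)).+1.
rewrite leNgt -ltr_pdivrMr// => /negP; apply.
exact: truncnS_gt.
Qed.

(* The iterates of the averaging operator are bounded, so its fixed space meets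
   the range of [1 - K] trivially and the two span by dimension. *)
Lemma poisson (c : S -> R) : exists u v : S -> R,
  (forall x, c x = u x + v x - mean mu (v \o F x)) /\
  (forall x, u x = mean mu (u \o F x)).
Proof.
pose f := linfun (resolvent mu F 1).
have fE (v : {ffun S -> R^o}) x : f v x = v x - mean mu (v \o F x).
  by rewrite lfunE /= ffunE mul1r.
have kerP (v : {ffun S -> R^o}) x : v \in lker f -> mean mu (v \o F x) = v x.
  by rewrite memv_ker => /eqP/ffunP/(_ x); rewrite fE ffunE => /subr0_eq.
have cap0 : (lker f :&: limg f = 0)%VS.
  apply/eqP; rewrite -subv0; apply/subvP => w; rewrite memv_cap memv0.
  case/andP => kw /memv_imgP[z _ wz].
  pose B := \sum_x `|z x|.
  have zB x : `|z x| <= B by rewrite /B (bigD1 x)//= lerDl sumr_ge0.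
  (* Since [K z = z - w] and [K w = w], the function [z - m w] is the [m]-th iterate of the
     averaging operator at [z]. A bound uniform in [m] forces [w = 0]. *)
  have zm (m : nat) x : `|z x - m%:R * w x| <= B.
    elim: m x => [|m IHm] x; first by rewrite mul0r subr0.
    have -> : z x - m.+1%:R * w x = mean mu (fun y => z (F x y) - m%:R * w (F x y)).
      rewrite meanB meanZ -/(mean mu (z \o F x)) -/(mean mu (w \o F x)).
      rewrite (kerP w)//; have /ffunP/(_ x) := wz; rewrite fE => wx.
      rewrite -natr1 mulrDl mul1r; lra.
    exact: mean_norm_le.
  apply/eqP/ffunP => x; rewrite ffunE.
  apply: (@eq0_of_natmul_bounded _ (B + B)) => m.
  rewrite -[X in X * _]ger0_norm ?ler0n// -normrM.
  have -> : m%:R * w x = z x - (z x - m%:R * w x) by ring.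
  by rewrite (le_trans (ler_normB _ _))// lerD.
have full : (lker f + limg f)%VS = fullv.
  apply/eqP; rewrite eqEdim subvf /=.
  by rewrite dimv_disjoint_sum// -(limg_ker_dim f fullv) capfv.
have : ([ffun x => c x] : {ffun S -> R^o}) \in (lker f + limg f)%VS by rewrite full memvf.
case/memv_addP => u ku [w /memv_imgP[v _ ->] cE].
exists u, v; split=> x; last by rewrite kerP.
by have /ffunP/(_ x) := cE; rewrite !ffunE fE => ->; rewrite addrA.
Qed.

End Poisson.

(** * Discounted decision processes and vanishing discount *)

Section DecisionProcess.
Context {R : realType} {S A Y : finType} (mu : Y -> R) (F : S -> A -> Y -> S)
  (good : pred A).
Hypotheses (mu_ge0 : forall y, 0 <= mu y) (mu_sum1 : \sum_y mu y = 1).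

Definition discount_optimal (c : S -> A -> R) (a : R) (sigma : S -> A) (V : S -> R) :=
  [/\ forall x, good (sigma x),
      forall x, V x = c x (sigma x) + a * mean mu (V \o F x (sigma x)) &
      forall x b, good b -> V x <= c x b + a * mean mu (V \o F x b)].

(* Policy improvement: a stationary policy minimizing [\sum_x V x] cannot be
   improved in any state. *)
Lemma discount_optimal_exists (c : S -> A -> R) (a : R) (b0 : A) :
  good b0 -> 0 <= a -> a < 1 ->
  exists (sigma : {ffun S -> A}) (V : S -> R), discount_optimal c a sigma V.
Proof.
move=> good0 a0 a1.
pose W (sigma : {ffun S -> A}) := sval (cid
  (discounted_value (fun x => F x (sigma x)) mu_ge0 mu_sum1
     (fun x => c x (sigma x)) a0 a1)).
have WE sigma x : W sigma x = c x (sigma x) + a * mean mu (W sigma \o F x (sigma x)).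
  by rewrite /W; case: cid => V /= ->.
pose stat (sigma : {ffun S -> A}) := [forall x, good (sigma x)].
have stat0 : stat [ffun=> b0] by apply/forallP => x; rewrite ffunE.
case: (arg_minP (fun sigma => \sum_x W sigma x) stat0) => sigma /forallP sg minW.
exists sigma, (W sigma); split=> // x0 b gb; rewrite leNgt; apply/negP => lt0.
(* Changing [sigma] only at [x0], where [b] violates the Bellman inequality, lowers the value at
   [x0] and raises it nowhere, against the minimality of the sum. *)
pose sigma' : {ffun S -> A} := [ffun x => if x == x0 then b else sigma x].
have sg' : stat sigma' by apply/forallP => x; rewrite ffunE; case: ifP.
have le1 x : c x (sigma' x) + a * mean mu (W sigma \o F x (sigma' x)) <= W sigma x.
  by rewrite ffunE; case: eqP => [->|_]; [exact: ltW|rewrite -WE].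
have le2 x : W sigma' x <= W sigma x.
  rewrite -subr_le0.
  apply: (@maximum_principle R Y mu mu_ge0 mu_sum1 S predT
    (fun x => F x (sigma' x)) a 0 (fun x => W sigma' x - W sigma x)) => // y _.
  rewrite meanB -/(mean mu (W sigma' \o F y (sigma' y)))
    -/(mean mu (W sigma \o F y (sigma' y))).
  have := WE sigma' y; have := le1 y; lra.
have lt3 : W sigma' x0 < W sigma x0.
  apply: le_lt_trans lt0; rewrite WE !ffunE eqxx lerD2l ler_wpM2l//.
  by apply: le_mean => // y; exact: le2.
have := minW _ sg'; rewrite leNgt => /negP; apply.
rewrite [ltLHS](bigD1 x0)//= [ltRHS](bigD1 x0)//= ltr_leD// ler_sum//.
Qed.

Variable rank : S -> nat.
Hypothesis reach : forall x, (0 < rank x)%N ->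
  exists b y, [/\ good b, 0 < mu y & (rank (F x b y) < rank x)%N].

(** A common positive lower bound for the positive atoms: every factor is at most 1, so the product
    lies below each of them. *)
Let eps := \prod_(y | 0 < mu y) mu y.

Let eps_gt0 : 0 < eps. Proof. exact: prodr_gt0. Qed.

Let eps_le y : 0 < mu y -> eps <= mu y.
Proof.
move=> y0; suff /andP[_ p1] : 0 <= \prod_(z | (0 < mu z) && (z != y)) mu z <= 1.
  by rewrite /eps (bigD1 y)//= ler_piMr.
apply: (big_ind (fun p : R => 0 <= p <= 1)) => [|p q|z _].
- by rewrite ler01 lexx.
- by case/andP => p0 p1 /andP[q0 q1]; rewrite mulr_ge0 //= mulr_ile1.
- by rewrite mu_ge0 (le_atom1 mu_ge0 mu_sum1).
Qed.

(** Near-maximality of [V] passes down the ranks. If [V x] is within [k] of the maximum and [x'] is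
    reached through the atom [y], the Bellman inequality gives [mu y * (V x - V x') <= 2 * B + k];
    one [B] bounds the cost, the other the discounting defect [(1 - a) * V]. So [k] grows by at most
    [(2 * B + k) / eps] per rank, whatever [a] and [V] are. *)
Lemma rank0_of_max (c : S -> A -> R) (B : R) : (forall x b, `|c x b| <= B) ->
  forall (r : nat) (k : R), 0 <= k -> exists k' : R, forall (a : R) (V : S -> R) (x : S),
  0 <= a -> a < 1 -> (forall z, (1 - a) * `|V z| <= B) ->
  (forall x b, good b -> V x <= c x b + a * mean mu (V \o F x b)) ->
  (rank x <= r)%N -> (forall z, V z <= V x + k) ->
  exists x', rank x' = 0%N /\ forall z, V z <= V x' + k'.
Proof.
move=> cB; elim=> [|r IH] k k0.
  by exists k => a V x _ _ _ _; rewrite leqn0 => /eqP rx Vk; exists x.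
case: (pselect (0 <= B)) => [B0|nB]; last first.
  (* For negative [B] the bound on [V] already fails at [x]. *)
  exists 0 => a V x a0 a1 VB _ _ _; exfalso; apply: nB.
  by apply: le_trans (VB x); rewrite mulr_ge0// subr_ge0 ltW.
have q0 : 0 <= (2 * B + k) / eps.
  by apply: divr_ge0; [rewrite addr_ge0// mulr_ge0|exact: ltW].
have kk0 : 0 <= k + (2 * B + k) / eps by rewrite addr_ge0.
have [k' hk'] := IH _ kk0.
exists k' => a V x a0 a1 VB Vb rx Vk.
case: (posnP (rank x)) => [rx0|/reach [b [y [gb y0 ry]]]].
  apply: (hk' a V x) => //; first by rewrite rx0.
  move=> z; rewrite (le_trans (Vk z))// lerD2l lerDl//.
apply: (hk' a V (F x b y)) => //; first by rewrite -ltnS (leq_trans ry).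
set x' := F x b y; set q := (_ + k) / _ in q0 * => z.
have qE : q * eps = 2 * B + k by rewrite /q divfK// gt_eqF.
have le1 : mean mu (V \o F x b) <= mu y * V x' + (1 - mu y) * (V x + k).
  by apply: (mean_le_atom mu_ge0 mu_sum1 y (f := V \o F x b)) => t /=; exact: Vk.
have le2 : (a - 1) * mean mu (V \o F x b) <= B.
  have le3 : `|mean mu (V \o F x b)| * (1 - a) <= B.
    rewrite -ler_pdivlMr ?subr_gt0//; apply: mean_norm_le => // t /=.
    by rewrite ler_pdivlMr ?subr_gt0// mulrC.
  have := ler_norm (- mean mu (V \o F x b)); rewrite normrN; nra.
have le4 := Vb x b gb.
have le5 : c x b <= B by apply: le_trans (ler_norm _) _.
have le6 : mu y * q >= 2 * B + k by rewrite -qE mulrC ler_wpM2r// eps_le.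
have le7 : mu y * V x <= mu y * (V x' + q).
  have := mulr_ge0 (mu_ge0 y) k0; nra.
have := Vk z; move: le7; rewrite ler_pM2l//; lra.
Qed.

(** Every rank-zero state is within [C] of the minimum of [V], and by [rank0_of_max] some rank-zero
    state is within [k] of its maximum; neither constant depends on the discount factor. *)
Lemma discount_optimal_osc (c : S -> A -> R) (C : R) :
  (forall a sigma V, 0 <= a -> a < 1 -> discount_optimal c a sigma V ->
     forall x y, rank x = 0%N -> V x <= V y + C) ->
  exists C' : R, forall a sigma V, 0 <= a -> a < 1 -> discount_optimal c a sigma V ->
     forall x y, V x <= V y + C'.
Proof.
move=> hC; pose B := \sum_x \sum_b `|c x b|.
have cB x b : `|c x b| <= B.
  rewrite /B (bigD1 x)//= (bigD1 b)//= -addrA lerDl addr_ge0 ?sumr_ge0//.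
  by move=> i _; apply: sumr_ge0.
have [k hk] := rank0_of_max cB (\max_x rank x) (lexx 0).
exists (C + k) => a sigma V a0 a1 opt x y; have [_ VE Vb] := opt.
have VB := discounted_bound mu_ge0 mu_sum1 a0 a1 (fun z => cB z (sigma z)) VE.
have [m _ maxm] := @arg_maxP _ _ _ x predT V isT.
have [|z|x' [rx' Vx']] := hk a V m a0 a1 VB Vb; first exact: leq_bigmax.
  by rewrite addr0; exact: maxm.
have := hC _ _ _ a0 a1 opt x' y rx'; have := Vx' x; lra.
Qed.

Lemma pigeonhole (T : finType) (s : nat -> T) :
  exists t, forall N, exists2 m, (N <= m)%N & s m = t.
Proof.
apply: contrapT => /forallNP h.
have h' t : exists N, forall m, (N <= m)%N -> s m <> t.
  move/existsNP: (h t) => [N hN]; exists N => m Nm st; apply: hN; by exists m.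
have [b hb] := choice h'.
by apply: (hb (s (\max_t b t)) (\max_t b t)) => //; exact: leq_bigmax.
Qed.

Lemma div_natS_small (e k : R) : 0 < e ->
  exists N : nat, forall m, (N <= m)%N -> k / m.+2%:R <= e.
Proof.
move=> e0; exists (Num.truncn (k / e)).+1 => m Nm.
rewrite ler_pdivrMr ?ltr0n// mulrC -ler_pdivrMr//.
apply: le_trans (ltW (truncnS_gt _)) _.
by rewrite ler_nat (leq_trans Nm)// -addn2 leq_addr.
Qed.

(** The leading term of the Laurent expansion of the discounted value at [a = 1]. Once the gain term
    [u / (1 - a)] and the bias [v] are removed, the remainder [D] is a discounted value whose cost
    is [1 - a] times a bounded function, so it is bounded uniformly in [a]. *)
Lemma discounted_near_gain (F' : S -> Y -> S) (a : R) (c u v V : S -> R) :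
  0 <= a -> a < 1 ->
  (forall x, c x = u x + v x - mean mu (v \o F' x)) ->
  (forall x, u x = mean mu (u \o F' x)) ->
  (forall x, V x = c x + a * mean mu (V \o F' x)) ->
  forall x, `|V x - u x / (1 - a)| <= 2 * \sum_z `|v z|.
Proof.
move=> a0 a1 cE uE VE x; set M := \sum_z `|v z|.
have vM z : `|v z| <= M by rewrite /M (bigD1 z)//= lerDl sumr_ge0.
have vM' z : - M <= v z /\ v z <= M.
  by have := vM z; rewrite ler_norml => /andP[].
have a1' : 1 - a != 0 by rewrite subr_eq0 gt_eqF.
have mM z : - M <= mean mu (v \o F' z) /\ mean mu (v \o F' z) <= M.
  have : `|mean mu (v \o F' z)| <= M by apply: mean_norm_le => // t /=.
  by rewrite ler_norml => /andP[].
pose D z := V z - u z / (1 - a) - v z.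
have DE z : D z = a * mean mu (D \o F' z) + (1 - a) * - mean mu (v \o F' z).
  have -> : mean mu (D \o F' z) =
      mean mu (V \o F' z) - u z / (1 - a) - mean mu (v \o F' z).
    rewrite (eq_mean _ (g := fun t => V (F' z t) - (1 - a)^-1 * u (F' z t) - v (F' z t))).
      by rewrite !meanB meanZ [in RHS](uE z) mulrC.
    by move=> t; rewrite /D /= (mulrC _ (u _)).
  rewrite /D VE cE.
  have : u z = u z / (1 - a) * (1 - a) by rewrite divfK.
  by set p := u z / _ => pE; rewrite pE; ring.
have up : D x <= M.
  apply: (maximum_principle mu_ge0 mu_sum1 (Q := predT) (F := F') a0 a1) => // z _.
  rewrite {1}DE lerD2l ler_wpM2l//; first by rewrite subr_ge0 ltW.
  by have [] := mM z; lra.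
have dn : - D x <= M.
  have maxD := @maximum_principle R Y mu mu_ge0 mu_sum1 S predT F' a M (fun t => - D t) a0 a1.
  apply: maxD => // t _. 
  rewrite (eq_mean _ (g := fun y => -1 * D (F' t y))); last by move=> y; rewrite mulN1r.
  rewrite meanZ DE -/(mean mu (D \o F' t)); have [] := mM t; nra.
rewrite ler_norml; have [] := vM' x; move: up dn; rewrite /D; lra.
Qed.

(* Vanishing discount: one stationary policy is discount optimal for discount
   factors arbitrarily close to 1; its gain is constant because the discounted
   values have uniformly bounded oscillation. *)
Lemma vanishing_discount (I : finType) (w : I -> R) (c : I -> S -> A -> R)
    (C : R) (x0 : S) (b0 : A) : good b0 ->
  (forall a sigma V, 0 <= a -> a < 1 ->
     discount_optimal (fun x b => \sum_i w i * c i x b) a sigma V ->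
     forall x y, rank x = 0%N -> V x <= V y + C) ->
  exists (sigma : S -> A) (u v : I -> S -> R) (g : R),
  [/\ forall x, good (sigma x),
      forall i x, c i x (sigma x) = u i x + v i x - mean mu (v i \o F x (sigma x)),
      forall i x, u i x = mean mu (u i \o F x (sigma x)),
      forall x, \sum_i w i * u i x = g &
      forall e : R, 0 < e -> exists (a : R) (V : S -> R) (k : R),
        [/\ 0 <= a, a < 1,
            discount_optimal (fun x b => \sum_i w i * c i x b) a sigma V,
            (1 - a) * k <= e &
            forall x, `|V x - g / (1 - a)| <= k]].
Proof.
move=> good0 hC; set ct := (fun x b => \sum_i w i * c i x b) in hC *.
pose al (m : nat) : R := 1 - m.+2%:R^-1.
have al1 m : al m < 1 by rewrite ltrBlDr ltrDl invr_gt0 ltr0n.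
have al0 m : 0 <= al m by rewrite subr_ge0 invf_le1 ?ltr0n// ler1n.
have alE m : 1 - al m = m.+2%:R^-1 by rewrite /al subKr.
have [s hs] := choice (fun m => discount_optimal_exists ct good0 (al0 m) (al1 m)).
(* There are finitely many stationary policies, so one of them is optimal for infinitely many of the
   factors [al m]. *)
have [sigma hsig] := pigeonhole s.
have sgood x : good (sigma x).
  by have [m _ sm] := hsig 0%N; have [V []] := hs m; rewrite sm.
have /choice[u /choice[v hv]] : forall i, exists u v : S -> R,
    (forall x, c i x (sigma x) = u x + v x - mean mu (v \o F x (sigma x))) /\
    (forall x, u x = mean mu (u \o F x (sigma x))).
  move=> i; exact: (poisson (fun x => F x (sigma x)) mu_ge0 mu_sum1
                      (fun x => c i x (sigma x))).
pose U x := \sum_i w i * u i x; pose W x := \sum_i w i * v i x.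
have mE (f : I -> S -> R) x : mean mu ((fun x => \sum_i w i * f i x) \o F x (sigma x)) =
    \sum_i w i * mean mu (f i \o F x (sigma x)).
  rewrite /mean; under eq_bigr do rewrite mulr_sumr.
  rewrite exchange_big; apply: eq_bigr => i _; rewrite mulr_sumr.
  by apply: eq_bigr => y _; rewrite mulrCA.
have ctE x : ct x (sigma x) = U x + W x - mean mu (W \o F x (sigma x)).
  rewrite /U /W mE -big_split -sumrB; apply: eq_bigr => i _ /=.
  by rewrite (hv i).1; ring.
have UE x : U x = mean mu (U \o F x (sigma x)).
  by rewrite mE; apply: eq_bigr => i _; rewrite -(hv i).2.
have [C' hC'] := discount_optimal_osc hC.
set k := 2 * \sum_z `|W z|.
have near m V : discount_optimal ct (al m) sigma V ->
    forall x, `|V x - U x / (1 - al m)| <= k.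
  move=> [_ VE _] x.
  exact: (discounted_near_gain (F' := fun x => F x (sigma x))
    (c := fun x => ct x (sigma x)) (al0 m) (al1 m) ctE UE VE).
(* Bounded oscillation of [V] keeps [(U x - U y) / (1 - al m)] below [C' + 2 * k] while [1 - al m]
   tends to 0 along the factors served by [sigma]. *)
have Ule x y : U x <= U y.
  apply/ler_addgt0Pr => e e0.
  have [N hN] := div_natS_small (C' + 2 * k) e0.
  have [m Nm sm] := hsig N; have [V] := hs m; rewrite sm => opt.
  have := hN m Nm; rewrite -alE => small.
  have := hC' _ _ _ (al0 m) (al1 m) opt x y.
  have := near m V opt x; have := near m V opt y.
  rewrite !ler_norml => /andP[_ h1] /andP[h2 _] h3.
  have a1 : 0 < 1 - al m by rewrite subr_gt0.
  have h4 : (U x - U y) / (1 - al m) <= C' + 2 * k by rewrite mulrBl; lra.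
  by move: h4; rewrite ler_pdivrMr//; lra.
exists sigma, u, v, (U x0); split=> //.
- by move=> i x; rewrite (hv i).1.
- by move=> i x; exact: (hv i).2.
- by move=> x; apply/eqP; rewrite eq_le !Ule.
move=> e e0; have [N hN] := div_natS_small k e0.
have [m Nm sm] := hsig N; have [V] := hs m; rewrite sm => opt.
exists (al m), V, k; split=> //; first by rewrite alE mulrC hN.
move=> x; have -> : U x0 = U x by apply/eqP; rewrite eq_le !Ule.
exact: near.
Qed.

End DecisionProcess.

(** * The slot dynamics *)

Section Network.
Context {R : realType} (M : network R).

(** All the randomness of one slot, with arrivals cut off at the buffer sizes so that the type is
    finite. *)
Definition obs :=
  ({ffun 'I_(nMS M) * 'I_(nBS M) -> fval M} * {ffun 'I_(nMS M) -> 'I_(NQ M).+1} *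
   {ffun 'I_(nBS M) -> 'I_(NE M).+1})%type.
Definition pstate := (energy M * queues M)%type.
(** Scheduling sees the CSI of the slot while DTX does not; an action on the partial state therefore
    carries a whole map from CSI to scheduling actions. *)
Definition act := (bs_act M * {ffun csi M -> ms_act M})%type.

Definition obs_channel (y : obs) : channel M := fun k b => ssval (y.1.1 (k, b)).
Definition obs_csi (y : obs) : csi M := [ffun k => y.1.1 (k, assoc k)].

Definition slot (x : pstate) (pE pG : bs_act M) (s : csi M -> ms_act M) (y : obs) : pstate :=
  (next_energy x.1 pE (fun b => y.2 b),
   next_queues x.2 (obs_channel y) (dtx pE pG) (s (obs_csi y)) (fun k => y.1.2 k)).

Definition renew_part (e : energy M) (p : bs_act M) : bs_act M :=
  [ffun b => p b && (0 < e b)%N].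
Definition grid_part (e : energy M) (p : bs_act M) : bs_act M :=
  [ffun b => p b && (e b == 0%N :> nat)].

Lemma dtx_parts e p : dtx (renew_part e p) (grid_part e p) = p.
Proof. by apply/ffunP => b; rewrite !ffunE lt0n; case: (p b); case: eqP. Qed.

Lemma greedy_parts e p : greedy_split e (renew_part e p) (grid_part e p).
Proof. by move=> b; rewrite dtx_parts !ffunE. Qed.

Lemma feasible_parts (hP : forall p p' : bs_act M,
      p \in dtx_set M -> (forall b, p' b -> p b) -> p' \in dtx_set M) e p s :
  p \in dtx_set M -> s \in sched_set M -> admissible (@assoc R M) p s ->
  feasible_action e (renew_part e p) (grid_part e p) s.
Proof.
move=> pP sS adm; rewrite /feasible_action dtx_parts; split=> //.
- by split=> //; apply: hP pP _ => b; rewrite ffunE => /andP[].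
- by move=> b e0; rewrite ffunE e0 andbF.
- by move=> b; rewrite !ffunE lt0n; case: (p b); case: eqP.
Qed.

Definition good_act (a : act) : bool :=
  (a.1 \in dtx_set M) &&
  [forall H, (a.2 H \in sched_set M) &&
     [forall b, (\sum_(k | assoc k == b) a.2 H k)%N == a.1 b]].

Lemma good_actP (a : act) : reflect
  (a.1 \in dtx_set M /\ forall H, a.2 H \in sched_set M /\ admissible (@assoc R M) a.1 (a.2 H))
  (good_act a).
Proof.
apply: (iffP andP) => [[aP /forallP h]|[aP h]]; split=> //.
  by move=> H; have /andP[sS /forallP adm] := h H; split=> // b; exact/eqP.
by apply/forallP => H; have [-> adm] := h H; apply/forallP => b; exact/eqP.
Qed.

Definition greedy_slot (x : pstate) (a : act) (y : obs) : pstate :=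
  slot x (renew_part x.1 a.1) (grid_part x.1 a.1) a.2 y.

Definition cost_weight (i : 'I_(nMS M) + 'I_(nBS M)) : R :=
  match i with inl k => beta k | inr b => gamma b end.

Definition cost_part (i : 'I_(nMS M) + 'I_(nBS M)) (x : pstate) (pG : bs_act M) : R :=
  match i with inl k => cost M (x.2 k) | inr b => (pG b)%:R end.

Definition greedy_cost i (x : pstate) (a : act) : R := cost_part i x (grid_part x.1 a.1).

(** The truncated difference counts only the units that [x1] lacks against [x2], each priced at one
    unit of grid energy. *)
Definition energy_gap (x1 x2 : pstate) : R :=
  \sum_b gamma b * (x2.1 b - x1.1 b)%N%:R.

Definition queues_le (x1 x2 : pstate) : bool := [forall k, (x1.2 k <= x2.2 k)%N].

Lemma next_energyE (e : energy M) pE a b :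
  next_energy e pE a b = minn (e b - pE b + a b) (NE M) :> nat.
Proof. by rewrite ffunE inordK// ltnS geq_minr. Qed.

Lemma next_queuesE (q : queues M) h p s a k :
  next_queues q h p s a k =
  minn (q k - (threshold k <= sinr h p s k)%R + a k) (NQ M) :> nat.
Proof. by rewrite ffunE inordK// ltnS geq_minr. Qed.

Lemma slot_queue (x : pstate) pE pG p s (y : obs) k : dtx pE pG = p ->
  (slot x pE pG s y).2 k = minn (x.2 k -
    (threshold k <= sinr (obs_channel y) p (s (obs_csi y)) k)%R + y.1.2 k) (NQ M) :> nat.
Proof. by move=> <-; exact: next_queuesE. Qed.

Lemma greedy_slot_queue (x : pstate) (a : act) (y : obs) k :
  (greedy_slot x a y).2 k = minn (x.2 k -
    (threshold k <= sinr (obs_channel y) a.1 (a.2 (obs_csi y)) k)%R + y.1.2 k) (NQ M) :> nat.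
Proof. exact: slot_queue (dtx_parts _ _). Qed.

Lemma energy_gap_ge0 x1 x2 : 0 <= energy_gap x1 x2.
Proof. by apply: sumr_ge0 => b _; rewrite mulr_ge0// ltW// gamma_gt0. Qed.

Lemma leq_update (u1 u2 q1 q2 a N : nat) (served : bool) :
  u1 = minn (q1 - served + a) N -> u2 = minn (q2 - served + a) N ->
  (q1 <= q2)%N -> (u1 <= u2)%N.
Proof. by move=> -> ->; case: served; lia. Qed.

Lemma ltn_update (u q a N : nat) (served : bool) :
  u = minn (q - served + a) N -> served -> a = 0%N -> (0 < q)%N -> (u < q)%N.
Proof. by move=> -> -> ->; lia. Qed.

Lemma queues_le_slot x1 x2 a y : queues_le x1 x2 ->
  queues_le (greedy_slot x1 a y) (greedy_slot x2 a y).
Proof.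
move=> /forallP le12; apply/forallP => k.
exact: leq_update (greedy_slot_queue x1 a y k) (greedy_slot_queue x2 a y k) (le12 k).
Qed.

(** Where [x1] draws from the grid and [x2] does not, [x1] is empty and [x2] spends a stored unit,
    so the gap shrinks by exactly what [x1] pays. Elsewhere the gap cannot grow, and capping can
    only reduce it. *)
Lemma energy_gap_slot x1 x2 a y :
  \sum_b gamma b * (grid_part x1.1 a.1 b)%:R +
    energy_gap (greedy_slot x1 a y) (greedy_slot x2 a y) <=
  energy_gap x1 x2 + \sum_b gamma b * (grid_part x2.1 a.1 b)%:R.
Proof.
rewrite -!big_split ler_sum//= => b _.
rewrite -!mulrDr ler_pM2l ?gamma_gt0// -!natrD ler_nat /= !next_energyE !ffunE.
case: (a.1 b) => /=; case: (nat_of_ord (x1.1 b)) => [|e1]; case: (nat_of_ord (x2.1 b)) => [|e2];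
  rewrite /= ?eqxx //=; lia.
Qed.

(** A unit that the greedy split takes from storage instead of the grid is saved now and missing
    afterwards: the saving covers the gap that it opens. *)
Lemma energy_gap_greedy (x : pstate) (pE pG : bs_act M) (s : {ffun csi M -> ms_act M}) y :
  (forall b, x.1 b = 0%N :> nat -> pE b = false) ->
  (forall b, (pE b + pG b <= 1)%N) ->
  \sum_b gamma b * (grid_part x.1 (dtx pE pG) b)%:R +
    energy_gap (greedy_slot x (dtx pE pG, s) y) (slot x pE pG s y) <=
  \sum_b gamma b * (pG b)%:R.
Proof.
move=> pE0 pEG; rewrite -big_split ler_sum//= => b _.
rewrite -mulrDr ler_pM2l ?gamma_gt0// -!natrD ler_nat /= !next_energyE !ffunE.
have := pE0 b; have := pEG b.
case: (pE b); case: (pG b) => //=; case: (nat_of_ord (x.1 b)) => [|e1] //=; try lia.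
all: by move=> _ h; have := h erefl.
Qed.

Lemma queues_le_greedy (x : pstate) (pE pG : bs_act M) (s : {ffun csi M -> ms_act M}) y :
  queues_le (greedy_slot x (dtx pE pG, s) y) (slot x pE pG s y).
Proof. apply/forallP => k.
exact: leq_update (greedy_slot_queue x (dtx pE pG, s) y k)
  (slot_queue x s y k (erefl (dtx pE pG))) (leqnn _). Qed.

(** * Comparison of optimal discounted values by coupling *)

Section Values.
Variable mu : obs -> R.
Hypotheses (mu_ge0 : forall y, 0 <= mu y) (mu_sum1 : \sum_y mu y = 1).

Let total_cost x a := \sum_i cost_weight i * greedy_cost i x a.

Lemma total_costE x a : total_cost x a = \sum_k beta k * cost M (x.2 k) +
  \sum_b gamma b * (grid_part x.1 a.1 b)%:R.
Proof. by rewrite /total_cost big_sumType. Qed.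

(** From [x1], imitate under the same noise the action that is optimal at [x2]. The queues stay
    ordered, and by [energy_gap_slot] the extra grid cost is paid out of the gap. *)
Lemma optimal_value_gap a sigma V : 0 <= a -> a < 1 ->
  discount_optimal mu greedy_slot good_act total_cost a sigma V ->
  forall x1 x2, queues_le x1 x2 -> V x1 <= V x2 + energy_gap x1 x2.
Proof.
move=> a0 a1 [sg VE Vb] x1 x2 le12.
have maxD := @maximum_principle R obs mu mu_ge0 mu_sum1 (pstate * pstate)%type
  (fun x => queues_le x.1 x.2)
  (fun x y => (greedy_slot x.1 (sigma x.2) y, greedy_slot x.2 (sigma x.2) y)) a 0
  (fun x => V x.1 - V x.2 - energy_gap x.1 x.2) a0 a1.
suff: V x1 - V x2 - energy_gap x1 x2 <= 0 by lra.
apply: (maxD _ _ (x1, x2) le12) => {x1 x2 le12 maxD}.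
  by move=> [x1 x2] y /= le12; exact: queues_le_slot.
move=> [x1 x2] /= le12; rewrite mulr0 addr0.
pose b := sigma x2.
pose m1 := mean mu (V \o greedy_slot x1 b).
pose m2 := mean mu (V \o greedy_slot x2 b).
pose G := fun y => energy_gap (greedy_slot x1 b y) (greedy_slot x2 b y).
have h1 : V x1 <= total_cost x1 b + a * m1 := Vb x1 b (sg x2).
have h2 : V x2 = total_cost x2 b + a * m2 := VE x2.
have hm : mean mu ((fun x => V x.1 - V x.2 - energy_gap x.1 x.2) \o
    (fun y => (greedy_slot x1 b y, greedy_slot x2 b y))) = m1 - m2 - mean mu G.
  by rewrite /m1 /m2 -!meanB.
suff le : V x1 - V x2 - energy_gap x1 x2 <= a * (m1 - m2 - mean mu G).
  by apply: (le_trans le); rewrite le_eqVlt; apply/orP; left; apply/eqP; congr (a * _); exact: esym hm.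
(* The slot estimate leaves an undiscounted [- mean mu G], while the maximum principle asks for
   [- a * mean mu G]; nonnegativity bridges the two. *)
have G0 : 0 <= mean mu G.
  by apply: mean_ge => // y; exact: energy_gap_ge0.
have Gle : mean mu G <= energy_gap x1 x2 + \sum_b' gamma b' * (grid_part x2.1 b.1 b')%:R
    - \sum_b' gamma b' * (grid_part x1.1 b.1 b')%:R.
  by apply: mean_le => // y; have := energy_gap_slot x1 x2 b y; rewrite /G; lra.
have le_cost : \sum_k beta k * cost M (x1.2 k) <= \sum_k beta k * cost M (x2.2 k).
  apply: ler_sum => k _; rewrite ler_wpM2l ?(ltW (beta_gt0 k))//.
  by apply: (@cost_mono R M); exact: (forallP le12 k).
move: h1 h2; rewrite !total_costE; move: G0 Gle.
clearbody m1 m2; move: (mean mu G) => g; nra.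
Qed.

(** Provides the constant that [vanishing_discount] asks for, with the total backlog as rank: empty
    queues lie below all others, and no gap exceeds a full storage at every BS. *)
Lemma optimal_value_rank0 a sigma V : 0 <= a -> a < 1 ->
  discount_optimal mu greedy_slot good_act total_cost a sigma V ->
  forall x y : pstate, (\sum_k x.2 k)%N = 0%N ->
  V x <= V y + \sum_b gamma (n0 := M) b * (NE M)%:R.
Proof.
move=> a0 a1 opt x y x0.
have le0 : queues_le x y.
  apply/forallP => k; have : (x.2 k <= \sum_k x.2 k)%N by rewrite (bigD1 k)//= leq_addr.
  by rewrite x0 leqn0 => /eqP ->.
apply: (le_trans (optimal_value_gap a0 a1 opt le0)); rewrite lerD2l.
apply: ler_sum => b _; rewrite ler_pM2l ?gamma_gt0// ler_nat.
by rewrite (leq_trans (leq_subr _ _))// -ltnS ltn_ord.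
Qed.

(* Splitting greedily saves as much grid energy now as it costs later. *)
Lemma optimal_value_bellman a sigma V : 0 <= a -> a < 1 ->
  discount_optimal mu greedy_slot good_act total_cost a sigma V ->
  forall (H0 : csi M) x pE pG (s : csi M -> ms_act M),
  (forall H, feasible_action x.1 pE pG (s H)) ->
  V x <= \sum_i cost_weight i * cost_part i x pG + a * mean mu (V \o slot x pE pG s).
Proof.
move=> a0 a1 opt H0 x pE pG s feas; have [_ _ Vb] := opt.
have [[_ _ dtxP _] f1 f2 _] := feas H0.
pose s' : {ffun csi M -> ms_act M} := finfun s.
have ss' : slot x pE pG s =1 slot x pE pG s'.
  by move=> y; rewrite /slot ffunE.
pose b : act := (dtx pE pG, s').
have gb : good_act b.
  apply/good_actP; split=> // H /=.
  by rewrite ffunE; have [[_ _ _ ?] _ _ ?] := feas H.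
pose m := mean mu (V \o slot x pE pG s).
pose m' := mean mu (V \o greedy_slot x b).
have h : V x <= total_cost x b + a * m' := Vb x b gb.
have costE : \sum_i cost_weight i * cost_part i x pG =
    \sum_k beta k * cost M (x.2 k) + \sum_b gamma b * (pG b)%:R.
  by rewrite big_sumType.
pose G := fun y => energy_gap (greedy_slot x b y) (slot x pE pG s' y).
have G0 : 0 <= mean mu G.
  by apply: mean_ge => // y; exact: energy_gap_ge0.
have Gle : mean mu G <= \sum_b' gamma b' * (pG b')%:R
    - \sum_b' gamma b' * (grid_part x.1 b.1 b')%:R.
  by apply: mean_le => // y; have := energy_gap_greedy s' y f1 f2; rewrite /G; lra.
(* The greedy successor has the same queues and lacks at most the energy that [G] prices. *)
have mle : m' <= m + mean mu G.
  rewrite -meanD; apply: le_mean => // y /=; rewrite ss'.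
  by apply: (optimal_value_gap a0 a1 opt); exact: queues_le_greedy.
suff le : V x <= \sum_k beta k * cost M (x.2 k) + \sum_b gamma b * (pG b)%:R + a * m.
  by apply: (le_trans le); rewrite le_eqVlt; apply/orP; left; apply/eqP; congr (_ + a * _); exact: esym costE.
move: h; rewrite total_costE; move: G0 Gle mle.
clearbody m m'; move: (mean mu G) => g; nra.
Qed.

End Values.
End Network.

(** * Discrete random variables *)

Lemma bigsetIP (I : eqType) (T : Type) (r : seq I) (F : I -> set T) (w : T) :
  (\big[setI/setT]_(i <- r) F i) w <-> (forall i, i \in r -> F i w).
Proof.
elim: r => [|i r IH]; first by rewrite big_nil; split.
rewrite big_cons; split=> [[Fi /IH h] j|h].
  by rewrite inE => /orP[/eqP ->//|]; exact: h.
split; first by apply: h; rewrite inE eqxx.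
by apply/IH => j jr; apply: h; rewrite inE jr orbT.
Qed.

Section DiscreteMeasurability.
Context {d} {T : measurableType d}.

(** Measurability for the discrete sigma-algebra on the values, phrased by preimages so that [V]
    needs no measurable structure. *)
Definition dmeasurable (V : Type) (Z : T -> V) : Prop :=
  forall A : set V, measurable (Z @^-1` A).

Lemma dmeasurable_atoms (V : countType) (Z : T -> V) :
  (forall v, measurable (Z @^-1` [set v])) -> dmeasurable Z.
Proof.
move=> mZ A.
have -> : Z @^-1` A = \bigcup_(v : V) (if v \in A then Z @^-1` [set v] else set0).
  apply/seteqP; split=> [w Aw|w [v _]].
    by exists (Z w) => //; case: ifP => //; rewrite mem_set.
  by case: ifP => // vA /= Zw; rewrite /preimage/= Zw; exact: set_mem.
by apply: countable_bigcupT_measurable => // v; case: ifP.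
Qed.

Lemma dmeasurable_cst (V : Type) (v : V) : dmeasurable (fun _ : T => v).
Proof.
by move=> A; rewrite preimage_cst; case: ifP.
Qed.

Lemma dmeasurable_comp (V W : Type) (f : V -> W) (Z : T -> V) :
  dmeasurable Z -> dmeasurable (fun w => f (Z w)).
Proof. by move=> mZ A; exact: (mZ (f @^-1` A)). Qed.

Lemma dmeasurable_pair (V W : countType) (Z : T -> V) (Z' : T -> W) :
  dmeasurable Z -> dmeasurable Z' -> dmeasurable (fun w => (Z w, Z' w)).
Proof.
move=> mZ mZ'; apply: dmeasurable_atoms => -[v v'].
have -> : (fun w => (Z w, Z' w)) @^-1` [set (v, v')] =
    Z @^-1` [set v] `&` Z' @^-1` [set v'].
  by apply/seteqP; split=> w /= => [[-> ->]|[-> ->]].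
exact: measurableI.
Qed.

Lemma dmeasurable_ffun (I : finType) (V : countType) (Z : I -> T -> V) :
  (forall i, dmeasurable (Z i)) -> dmeasurable (fun w => [ffun i => Z i w]).
Proof.
move=> mZ; apply: dmeasurable_atoms => f.
have -> : (fun w => [ffun i => Z i w]) @^-1` [set f] =
    \big[setI/setT]_(i : I) (Z i @^-1` [set f i]).
  apply/seteqP; split=> w.
    by move=> /= fE; apply/bigsetIP => i _ /=; rewrite -fE ffunE.
  move/bigsetIP => h; apply/ffunP => i.
  by rewrite ffunE; apply: h; rewrite mem_index_enum.
by apply: bigsetI_measurable => i _; exact: mZ.
Qed.

Lemma dmeasurable_fun (R : realType) (V : Type) (Z : T -> V) (f : V -> \bar R) :
  dmeasurable Z -> measurable_fun setT (fun w => f (Z w)).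
Proof. by move=> mZ _ A _; rewrite setTI; exact: (mZ (f @^-1` A)). Qed.

End DiscreteMeasurability.

Section FiniteLaw.
Context {d} {T : measurableType d} {R : realType} (P : probability T R).

Definition prob (A : set T) : R := fine (P A).

Lemma probE A : measurable A -> P A = (prob A)%:E.
Proof. by move=> mA; rewrite fineK// fin_num_measure. Qed.

Lemma prob_ge0 A : 0 <= prob A.
Proof. exact: fine_ge0. Qed.

Lemma indic_decomposition (V : finType) (Z : T -> V) (f : V -> R) :
  (fun w => (f (Z w))%:E) =
  (fun w => \sum_v ((f v)%:E * (\1_(Z @^-1` [set v]) w)%:E)%E)%E.
Proof.
apply/funext => w; rewrite (bigD1 (Z w))//= big1 => [|v vZ].
  by rewrite adde0 indicE mem_set// mule1.
rewrite indicE memNset ?mule0//= => Zw; by rewrite Zw eqxx in vZ.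
Qed.

Lemma integrable_finite (V : finType) (Z : T -> V) (f : V -> R) : dmeasurable Z ->
  P.-integrable setT (fun w => (f (Z w))%:E).
Proof.
move=> mZ; rewrite indic_decomposition; apply: integrable_sum => // v _.
by apply: integrableZl => //; exact: integrable_indic.
Qed.

Lemma integral_finite (V : finType) (Z : T -> V) (f : V -> R) : dmeasurable Z ->
  (\int[P]_w (f (Z w))%:E = (\sum_v prob (Z @^-1` [set v]) * f v)%:E)%E.
Proof.
move=> mZ; rewrite indic_decomposition integral_sum//; last first.
  by move=> v; apply: integrableZl => //; exact: integrable_indic.
rewrite -sumEFin; apply: eq_bigr => v _; rewrite integralZl//; last first.
  exact: integrable_indic.
rewrite integral_indic// setIT mulrC EFinM; congr (_ * _)%E; exact/probE/mZ.
Qed.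

Lemma integral_finite_sum (V : finType) (Z : nat -> T -> V) (f : nat -> V -> R) n :
  (forall t, dmeasurable (Z t)) ->
  (\int[P]_w (\sum_(t < n) f t (Z t w))%:E =
   (\sum_(t < n) \sum_v prob (Z t @^-1` [set v]) * f t v)%:E)%E.
Proof.
move=> mZ; under eq_integral do rewrite -sumEFin.
rewrite integral_sum//; last by move=> t; exact: integrable_finite.
by rewrite -sumEFin; apply: eq_bigr => t _; exact: integral_finite.
Qed.

Lemma prob_sum1 (V : finType) (Z : T -> V) : dmeasurable Z ->
  \sum_v prob (Z @^-1` [set v]) = 1.
Proof.
move=> mZ; have := integral_finite (fun=> 1) mZ.
rewrite integral_cst// mul1e => /(congr1 fine).
rewrite -[X in fine X = _]/(P setT) probability_setT /= => ->.
by apply: eq_bigr => v _; rewrite mulr1.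
Qed.

Lemma prob_total (V : finType) (Z : T -> V) (A : set T) : dmeasurable Z -> measurable A ->
  prob A = \sum_v prob (A `&` Z @^-1` [set v]).
Proof.
move=> mZ mA.
have mW : dmeasurable (fun w => (Z w, w \in A)).
  apply: dmeasurable_pair => //; apply: dmeasurable_atoms => -[].
    rewrite (_ : _ @^-1` _ = A)//; apply/seteqP; split=> w /=.
      exact: set_mem.
    exact: mem_set.
  rewrite (_ : _ @^-1` _ = ~` A); first exact: measurableC.
  by apply/seteqP; split=> w /= => [/negbT/negP h Aw|Aw]; [apply: h; exact: mem_set|exact: memNset].
have := integral_finite (fun z : V * bool => z.2%:R) mW.
have -> : (fun w => ((w \in A)%:R)%:E) = (fun w => (\1_A w : R)%:E) by apply/funext => w; rewrite indicE.
rewrite integral_indic// setIT => PE.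
have {PE} -> : prob A = _ := congr1 fine PE.
rewrite /=.
transitivity (\sum_v \sum_(c : bool)
    prob ((fun w => (Z w, w \in A)) @^-1` [set (v, c)]) * c%:R).
  by rewrite pair_bigA; apply: eq_bigr => -[v c] _.
apply: eq_bigr => v _; rewrite big_bool/= mulr1 mulr0 addr0; congr prob.
apply/seteqP; split=> w /= => [[-> /set_mem]|[Aw ->]]//; by rewrite mem_set.
Qed.

End FiniteLaw.

(** * Finite chains driven by independent noise *)

Section Markov.
Context {d} {T : measurableType d} {R : realType} (P : probability T R).
Context {I : eqType} (E : I -> set (set T)) {S Y : finType}.
(** Independence is given for elementary variables indexed by [I]. The noise [Z t] is assembled from
    those in [idx t], and [A t y i] is what component [i] contributes to the atom [Z t = y]. *)
Variables (time : I -> nat) (idx : nat -> seq I) (A : nat -> Y -> I -> set T).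
Variables (Z : nat -> T -> Y) (x : nat -> T -> S) (G : nat -> S -> Y -> S) (s0 : S).
Hypotheses (indep : mutually_independent P E)
  (E_meas : forall i B, E i B -> measurable B)
  (idx_uniq : forall t, uniq (idx t))
  (idx_time : forall t i, i \in idx t -> time i = t)
  (A_E : forall t y i, i \in idx t -> E i (A t y i))
  (Z_atom : forall t y, Z t @^-1` [set y] = \big[setI/setT]_(i <- idx t) A t y i)
  (Z_meas : forall t, dmeasurable (Z t))
  (x_init : forall w, x 0 w = s0)
  (x_step : forall t w, x t.+1 w = G t (x t w) (Z t w)).

Lemma indep_prob (r : seq I) (B : I -> set T) : uniq r ->
  (forall i, i \in r -> E i (B i)) ->
  prob P (\big[setI/setT]_(i <- r) B i) = \prod_(i <- r) prob P (B i).
Proof.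
move=> ur rB; rewrite /prob indep//.
rewrite (eq_big_seq (fun i => (prob P (B i))%:E)) ?prodEFin// => i ir.
by apply: probE; apply: E_meas (rB i ir).
Qed.

Lemma measurable_bigsetI (r : seq I) (B : I -> set T) :
  (forall i, i \in r -> E i (B i)) -> measurable (\big[setI/setT]_(i <- r) B i).
Proof.
move=> rB; rewrite big_seq_cond; apply: bigsetI_measurable => i /andP[ir _].
exact: E_meas (rB i ir).
Qed.

Lemma state_dmeasurable t : dmeasurable (x t).
Proof.
elim: t => [|t IH].
  by rewrite (_ : x 0 = fun=> s0); [exact: dmeasurable_cst|exact/funext].
rewrite (_ : x t.+1 = fun w => (fun z : S * Y => G t z.1 z.2) (x t w, Z t w)).
  apply: (dmeasurable_comp (fun z : S * Y => G t z.1 z.2)).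
  exact: dmeasurable_pair.
by apply/funext => w; rewrite x_step.
Qed.

(* The state at time [t] is independent of all noise from time [t] on. *)
Lemma state_indep t (r : seq I) (B : I -> set T) s : uniq r ->
  (forall i, i \in r -> E i (B i)) -> (forall i, i \in r -> (t <= time i)%N) ->
  prob P (x t @^-1` [set s] `&` \big[setI/setT]_(i <- r) B i) =
  prob P (x t @^-1` [set s]) * \prod_(i <- r) prob P (B i).
Proof.
elim: t r B s => [|t IH] r B s ur rB rt.
  have -> : x 0%N @^-1` [set s] = if s0 == s then setT else set0.
    apply/seteqP; split=> w /=; rewrite x_init; case: eqP => //.
  case: eqP => _; last by rewrite set0I /prob measure0 /= mul0r.
  by rewrite setTI {2}/prob probability_setT mul1r; exact: indep_prob.
have mW : dmeasurable (fun w => (x t w, Z t w)).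
  by apply: dmeasurable_pair => //; exact: state_dmeasurable.
have mC : measurable (\big[setI/setT]_(i <- r) B i) by exact: measurable_bigsetI.
(* On each atom of the pair [(x t, Z t)] the event about [x t.+1] is decided. The atom of [Z t] then
   joins the later noise, and the induction hypothesis applies both with and without [r]. *)
have key (z : S * Y) : prob P ((x t.+1 @^-1` [set s] `&` \big[setI/setT]_(i <- r) B i) `&`
      (fun w => (x t w, Z t w)) @^-1` [set z]) =
    prob P (x t.+1 @^-1` [set s] `&` (fun w => (x t w, Z t w)) @^-1` [set z]) *
    \prod_(i <- r) prob P (B i).
  case: z => s1 y1; case: (eqVneq (G t s1 y1) s) => [Gs|Gs]; last first.
    have E0 (C : set T) : x t.+1 @^-1` [set s] `&` C `&`
        (fun w => (x t w, Z t w)) @^-1` [set (s1, y1)] = set0.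
      apply/seteqP; split=> // w [[/= + _] [e1 e2]]; rewrite x_step e1 e2 => e.
      by rewrite e eqxx in Gs.
    by have := E0 setT; rewrite setIT E0 => ->; rewrite /prob measure0 mul0r.
  have E1 (C : set T) : x t.+1 @^-1` [set s] `&` C `&`
      (fun w => (x t w, Z t w)) @^-1` [set (s1, y1)] =
      x t @^-1` [set s1] `&` (\big[setI/setT]_(i <- idx t) A t y1 i `&` C).
    rewrite -Z_atom; apply/seteqP; split=> w /=.
      by case=> [[_ Cw] [-> ->]].
    case=> xs [Zy Cw]; rewrite x_step xs Zy; split=> //; by split.
  have -> : x t.+1 @^-1` [set s] `&` (fun w => (x t w, Z t w)) @^-1` [set (s1, y1)] =
      x t @^-1` [set s1] `&` (\big[setI/setT]_(i <- idx t) A t y1 i).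
    by have := E1 setT; rewrite !setIT.
  rewrite E1.
  (* One family serves both index lists, which are disjoint because their times differ. *)
  pose B' i := if i \in idx t then A t y1 i else B i.
  have notin i : i \in r -> i \notin idx t.
    by move=> ir; apply/negP => /idx_time it; have := rt i ir; rewrite it ltnn.
  have big1 : \big[setI/setT]_(i <- idx t) A t y1 i = \big[setI/setT]_(i <- idx t) B' i.
    by apply: eq_big_seq => i it; rewrite /B' it.
  have big2 : \big[setI/setT]_(i <- r) B i = \big[setI/setT]_(i <- r) B' i.
    by apply: eq_big_seq => i /notin /negbTE ir; rewrite /B' ir.
  have big3 : \prod_(i <- r) prob P (B i) = \prod_(i <- r) prob P (B' i).
    by apply: eq_big_seq => i /notin /negbTE ir; rewrite /B' ir.
  have B'E i : i \in idx t ++ r -> E i (B' i).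
    rewrite mem_cat /B'; case: ifP => [it _|_ /= ir]; [exact: A_E|exact: rB].
  have ucat : uniq (idx t ++ r).
    rewrite cat_uniq idx_uniq ur andbT; apply/hasPn => i; exact: notin.
  have tcat i : i \in idx t ++ r -> (t <= time i)%N.
    by rewrite mem_cat => /orP[/idx_time ->//|ir]; exact/ltnW/rt.
  rewrite big1 big2 big3 -big_cat (IH _ B' _ ucat B'E tcat) big_cat /= mulrA.
  congr (_ * _); rewrite (IH _ B')// => i it; last by rewrite (idx_time it).
  by apply: B'E; rewrite mem_cat it.
have mx := state_dmeasurable t.+1.
rewrite (prob_total P mW (measurableI _ _ (mx [set s]) mC)).
by rewrite [in RHS](prob_total P mW (mx [set s])) mulr_suml; apply: eq_bigr => z _.
Qed.

Lemma state_noise_indep t s y :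
  prob P ((fun w => (x t w, Z t w)) @^-1` [set (s, y)]) =
  prob P (x t @^-1` [set s]) * prob P (Z t @^-1` [set y]).
Proof.
have -> : (fun w => (x t w, Z t w)) @^-1` [set (s, y)] =
    x t @^-1` [set s] `&` Z t @^-1` [set y].
  by apply/seteqP; split=> w /= => [[-> ->]|[-> ->]].
rewrite Z_atom state_indep//; last by move=> i /idx_time ->.
- by rewrite indep_prob// => i; exact: A_E.
- by move=> i; exact: A_E.
Qed.

Lemma mean_state_step t (f : S -> R) :
  mean (fun s => prob P (x t.+1 @^-1` [set s])) f =
  mean (fun s => prob P (x t @^-1` [set s]))
    (fun s => mean (fun y => prob P (Z t @^-1` [set y])) (fun y => f (G t s y))).
Proof.
have mW : dmeasurable (fun w => (x t w, Z t w)).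
  by apply: dmeasurable_pair => //; exact: state_dmeasurable.
have := integral_finite P (fun z : S * Y => f (G t z.1 z.2)) mW.
have -> : (fun w => (f (G t (x t w) (Z t w)))%:E) = (fun w => (f (x t.+1 w))%:E).
  by apply/funext => w; rewrite x_step.
rewrite (integral_finite P f (state_dmeasurable t.+1)) => -[e].
apply: (etrans e).
transitivity (\sum_s \sum_y prob P ((fun w => (x t w, Z t w)) @^-1` [set (s, y)]) *
    f (G t s y)).
  by rewrite pair_bigA; apply: eq_bigr => -[s y] _.
apply: eq_bigr => s _; rewrite /mean mulr_sumr; apply: eq_bigr => y _.
by rewrite state_noise_indep mulrA.
Qed.

End Markov.

(** * Limits superior *)

Section Limsup.
Context {R : realType}.

Lemma limn_esup_inf (u : nat -> \bar R) : limn_esup u = ereal_inf (range (esups u)).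
Proof. by rewrite limn_esup_lim; apply/cvg_lim => //; exact: cvg_esups_inf. Qed.

Lemma esups_ge (u : nat -> \bar R) n m : (n <= m)%N -> (u m <= esups u n)%E.
Proof. by move=> nm; apply: ereal_sup_ubound; exists m. Qed.

Lemma esups_le (u : nat -> \bar R) n l : (forall m, u m <= l)%E -> (esups u n <= l)%E.
Proof. by move=> ul; apply: ge_ereal_sup => _ [m _ <-]. Qed.

Lemma le_limn_esup (u v : nat -> \bar R) :
  (forall n, u n <= v n)%E -> (limn_esup u <= limn_esup v)%E.
Proof.
move=> uv; rewrite !limn_esup_inf; apply: le_ereal_inf_tmp => _ [n _ <-].
apply: (@le_trans _ _ (esups u n)); first by apply: ereal_inf_lbound; exists n.
apply: ge_ereal_sup => _ [m /= nm <-]; apply: le_trans (uv m) _; exact: esups_ge.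
Qed.

Lemma limn_esup_bounded (u : nat -> R) (B : R) : (forall n, `|u n| <= B) ->
  exists l : R, limn_esup (fun n => (u n)%:E) = l%:E /\
    forall e, 0 < e -> exists N, forall n, (N <= n)%N -> u n <= l + e.
Proof.
move=> uB; set L := limn_esup _.
have uB' n : - B <= u n /\ u n <= B.
  by have := uB n; rewrite ler_norml => /andP[].
have LB : (L <= B%:E)%E.
  rewrite /L limn_esup_inf.
  apply: (@le_trans _ _ (esups (fun n => (u n)%:E) 0)).
    by apply: ereal_inf_lbound; exists 0%N.
  by apply: esups_le => m; rewrite lee_fin; have [] := uB' m.
have BL : ((- B)%:E <= L)%E.
  rewrite /L limn_esup_inf; apply: le_ereal_inf_tmp => _ [n _ <-].
  apply: (@le_trans _ _ (u n)%:E); first by rewrite lee_fin; have [] := uB' n.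
  exact: (@esups_ge (fun n => (u n)%:E)).
have Lfin : L \is a fin_num.
  by rewrite fin_numElt (lt_le_trans (ltNyr _) BL) (le_lt_trans LB (ltry _)).
exists (fine L); split; first by rewrite fineK.
move=> e e0.
have : (L < (fine L + e)%:E)%E by rewrite EFinD fineK// lteDl// lte_fin.
rewrite {1}/L limn_esup_inf => /ereal_inf_lt[_ [N _ <-] Nlt].
exists N => n Nn; rewrite -lee_fin; apply: le_trans (ltW Nlt).
exact: (@esups_ge (fun n => (u n)%:E)).
Qed.

Lemma cesaro_limn_esup (a : nat -> R) (l C : R) :
  (forall n, `|\sum_(t < n) a t - n%:R * l| <= C) ->
  limn_esup (fun n => (n%:R^-1 * \sum_(t < n) a t)%:E) = l%:E.
Proof.
move=> aC; apply: (cvg_limn_einf_sup _).2; apply: cvg_EFin; first exact: nearW.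
apply/cvgrPdist_le => e e0.
exists (Num.truncn (C / e)).+1 => // n /= Nn.
have n0 : 0 < n%:R :> R by rewrite ltr0n (leq_trans _ Nn).
have Cn : C <= n%:R * e.
  rewrite mulrC -ler_pdivrMl// mulrC; apply: (le_trans (ltW (truncnS_gt _))).
  by rewrite ler_nat.
have -> : l - n%:R^-1 * \sum_(t < n) a t = - (n%:R^-1 * (\sum_(t < n) a t - n%:R * l)).
  by field; rewrite gt_eqF.
have ninv : 0 <= n%:R^-1 :> R by rewrite invr_ge0.
rewrite normrN normrM (ger0_norm ninv) mulrC ler_pdivrMr// (mulrC e).
exact: le_trans (aC n) Cn.
Qed.

End Limsup.

(** * Greedy controls *)

Section GreedyControl.
Context {R : realType} {M : network R} {d : measure_display}
  {T : measurableType d} {P : probability T R} (X : exogenous M P) (chi1 : state M).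

Lemma AE_dmeasurable t b : dmeasurable (AE X t b).
Proof. by apply: dmeasurable_atoms => n; exact: AE_meas. Qed.

Lemma AQ_dmeasurable t k : dmeasurable (AQ X t k).
Proof. by apply: dmeasurable_atoms => n; exact: AQ_meas. Qed.

Lemma fad_dmeasurable t k b : dmeasurable (fad X t k b).
Proof. by apply: dmeasurable_atoms => n; exact: fad_meas. Qed.

Section Construction.
Variable c0 : @control R M d T.

(** Under greedy splitting the energy is driven by the DTX actions and arrivals alone, so it can be
    computed before the control that uses it. *)
Fixpoint greedy_energy t w : energy M :=
  if t is t'.+1 then
    next_energy (greedy_energy t' w) (renew_part (greedy_energy t' w) (c_dtx c0 t' w))
      (fun b => AE X t' b w)
  else st_E chi1.

Definition greedify : @control R M d T := Control
  (fun t w => renew_part (greedy_energy t w) (c_dtx c0 t w))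
  (fun t w => grid_part (greedy_energy t w) (c_dtx c0 t w))
  (c_sched c0).

Lemma greedify_energy t w : (traj X chi1 greedify t w).1 = greedy_energy t w.
Proof. by elim: t => //= t ->. Qed.

Lemma greedify_dtx t w : c_dtx greedify t w = c_dtx c0 t w.
Proof. exact: dtx_parts. Qed.

Lemma greedify_greedy : greedy_control X chi1 greedify.
Proof. move=> t w; rewrite greedify_energy; exact: greedy_parts. Qed.

Hypothesis feas0 : feasible_control X chi1 c0.

Lemma c_dtx_dmeasurable t : dmeasurable (c_dtx c0 t).
Proof.
have [m1 m2 _] := feas0.1 t.
apply: (dmeasurable_comp (fun z : bs_act M * bs_act M => dtx z.1 z.2)
  (Z := fun w => (c_renew c0 t w, c_grid c0 t w))).
by apply: dmeasurable_pair; exact: dmeasurable_atoms.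
Qed.

Lemma greedy_energy_dmeasurable t : dmeasurable (greedy_energy t).
Proof.
elim: t => [|t IH]; first exact: dmeasurable_cst.
pose f (z : energy M * bs_act M * {ffun 'I_(nBS M) -> nat}) : energy M :=
  next_energy z.1.1 (renew_part z.1.1 z.1.2) (fun b => z.2 b).
have -> : greedy_energy t.+1 =
    fun w => f (greedy_energy t w, c_dtx c0 t w, [ffun b => AE X t b w]).
  by apply/funext => w; apply/ffunP => b; rewrite /f /= !ffunE.
apply: dmeasurable_comp; apply: dmeasurable_pair.
  by apply: dmeasurable_pair => //; exact: c_dtx_dmeasurable.
by apply: dmeasurable_ffun => b; exact: AE_dmeasurable.
Qed.

Lemma feasible_greedify (hP : forall p p' : bs_act M,
    p \in dtx_set M -> (forall b, p' b -> p b) -> p' \in dtx_set M) :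
  feasible_control X chi1 greedify.
Proof.
split=> [t|t w]; last first.
  rewrite greedify_energy; have [[_ _ pP sS] _ _ adm] := feas0.2 t w.
  exact: feasible_parts.
have mz : dmeasurable (fun w => (greedy_energy t w, c_dtx c0 t w)).
  by apply: dmeasurable_pair; [exact: greedy_energy_dmeasurable|exact: c_dtx_dmeasurable].
have [_ _ m3] := feas0.1 t; split=> // a.
  exact: (dmeasurable_comp (fun z : energy M * bs_act M => renew_part z.1 z.2) mz).
exact: (dmeasurable_comp (fun z : energy M * bs_act M => grid_part z.1 z.2) mz).
Qed.

End Construction.

Lemma same_queues (c c' : @control R M d T) : same_dtx_sched c c' ->
  forall t w, (traj X chi1 c t w).2 = (traj X chi1 c' t w).2.
Proof.
move=> same; elim=> [//|t IH] w; have [e1 e2] := same t w.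
pose f q p s := next_queues q (channel_at X chi1 t w) p s (fun k => AQ X t k w).
have stepE c1 : (traj X chi1 c1 t.+1 w).2 =
  f (traj X chi1 c1 t w).2 (c_dtx c1 t w) (c_sched c1 t w) by [].
exact (etrans (stepE c) (etrans (f_equal3 f (IH w) e1 e2) (esym (stepE c')))).
Qed.

(* A unit of renewable energy spent early by the greedy control is one less
   unit of grid energy used so far. *)
Lemma greedify_grid_le c0 c : feasible_control X chi1 c -> same_dtx_sched c c0 ->
  forall b t w,
  (\sum_(i < t) c_grid (greedify c0) i w b <= \sum_(i < t) c_grid c i w b)%N /\
  ((traj X chi1 c t w).1 b + \sum_(i < t) c_grid (greedify c0) i w b <=
   greedy_energy c0 t w b + \sum_(i < t) c_grid c i w b)%N.
Proof.
move=> [_ feas] same b; elim=> [|t IH] w; first by rewrite !big_ord0.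
rewrite !big_ord_recr /= !next_energyE.
have [_ e0 le1 _] := feas t w; have [{}IH IH'] := IH w.
have := e0 b; have := le1 b.
have [+ _] := same t w => /ffunP/(_ b); rewrite !ffunE => pE.
rewrite -!pE; move: IH IH'.
move: (c_renew c t w b) (c_grid c t w b) => r g.
move: (\sum_(i < t) _)%N (\sum_(i < t) _)%N => G G'.
move: (nat_of_ord (greedy_energy c0 t w b)) (nat_of_ord ((traj X chi1 c t w).1 b)) => e e'.
move: (AE X t b w) => a.
case: r; case: g; case: e => [|e] //=; case: e' => [|e'] //=; rewrite ?subn0; try lia.
all: by move=> _ _ _ h; have := h erefl.
Qed.

Lemma greedify_optimal c0 c : feasible_control X chi1 (greedify c0) ->
  feasible_control X chi1 c -> same_dtx_sched c c0 ->
  (control_J X chi1 (greedify c0) <= control_J X chi1 c)%E.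
Proof.
move=> feasg feas same.
have sameg : same_dtx_sched (greedify c0) c.
  by move=> t w; have [e1 e2] := same t w; rewrite greedify_dtx e1.
rewrite /control_J; apply: leeD.
  rewrite le_eqVlt; apply/orP; left; apply/eqP; apply: eq_bigr => k _.
  apply: (congr1 (fun z => ((beta k)%:E * @limsup_avg R d T P z)%E)).
  apply/funext => t; apply/funext => w.
  by apply: (congr1 (fun q : queues M => cost M (q k))); exact: same_queues.
apply: lee_sum => b _; rewrite lee_pmul2l ?lte_fin ?gamma_gt0//.
apply: le_limn_esup => n; rewrite lee_wpmul2l ?lee_fin ?invr_ge0//.
have mg c' : feasible_control X chi1 c' ->
    measurable_fun setT (fun w => (\sum_(t < n) (c_grid c' t w b)%:R : R)%:E).
  move=> [mc' _].
  pose f (z : {ffun 'I_n -> bs_act M}) : \bar R := (\sum_(t < n) (z t b)%:R)%:E.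
  rewrite (_ : (fun w => _) = fun w => f [ffun t : 'I_n => c_grid c' t w]); last first.
    by apply/funext => w; rewrite /f; congr EFin; apply: eq_bigr => t _; rewrite ffunE.
  apply: dmeasurable_fun; apply: dmeasurable_ffun => t; have [_ m _] := mc' t.
  exact: dmeasurable_atoms.
apply: ge0_le_integral => //; try exact: mg.
  by move=> w _; rewrite lee_fin sumr_ge0.
move=> w _; rewrite lee_fin -!natr_sum ler_nat.
exact: (greedify_grid_le feas same b n w).1.
Qed.

End GreedyControl.

(** * The exogenous noise *)

Lemma prob_nat_law {d} {T : measurableType d} {R : realType} (P : probability T R)
    (Z Z' : T -> nat) : dmeasurable Z -> dmeasurable Z' ->
  (forall n, P (Z @^-1` [set n]) = P (Z' @^-1` [set n])) ->
  forall A, prob P (Z @^-1` A) = prob P (Z' @^-1` A).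
Proof.
move=> mZ mZ' ZZ' A; rewrite /prob; congr fine.
have E (U : T -> nat) : U @^-1` A = \bigcup_(n in A) U @^-1` [set n].
  apply/seteqP; split=> w; first by move=> Aw; exact: (ex_intro2 _ _ (U w) Aw erefl).
  by case=> n + /= e; rewrite -e.
have tr (U : T -> nat) : trivIset A (fun n => U @^-1` [set n]).
  by move=> i j _ _ [w [/= <- <-]].
rewrite (E Z) (E Z') !measure_bigcup//; by apply: eq_eseriesr => n _; exact: ZZ'.
Qed.

(** Markov's inequality: [Z] dominates the indicator of [Z != 0], so that event has probability at
    most [l]. *)
Lemma prob0_gt0 {d} {T : measurableType d} {R : realType} (P : probability T R)
    (Z : T -> nat) (l : R) : dmeasurable Z ->
  (\int[P]_w ((Z w)%:R)%:E = l%:E)%E -> l < 1 -> 0 < prob P (Z @^-1` [set 0%N]).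
Proof.
move=> mZ Zl l1.
have le1 : (\int[P]_w ((Z w != 0%N)%:R)%:E <= \int[P]_w ((Z w)%:R)%:E)%E.
  apply: ge0_le_integral => //.
  - exact: (dmeasurable_fun (fun n => ((n != 0%N)%:R)%:E) mZ).
  - exact: (dmeasurable_fun (fun n => (n%:R)%:E) mZ).
  - by move=> w _; rewrite lee_fin ler_nat; case: (Z w).
have mZ0 : dmeasurable (fun w => Z w != 0%N) by exact: (dmeasurable_comp (fun n => n != 0%N) mZ).
have := integral_finite P (fun b : bool => b%:R) mZ0.
have := prob_sum1 P mZ0.
rewrite !big_bool /= mulr1 mulr0 addr0 => s1 s2.
move: le1; rewrite s2 Zl lee_fin.
have -> : Z @^-1` [set 0%N] = (fun w => Z w != 0%N) @^-1` [set false].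
  by apply/seteqP; split=> w /=; [move=> ->|move/negbFE/eqP].
lra.
Qed.

Section Exogenous.
Context {R : realType} {M : network R} {d : measure_display}
  {T : measurableType d} {P : probability T R} (X : exogenous M P).

Definition exo_index : eqType := (nat * 'I_(nMS M) * 'I_(nBS M) + nat * 'I_(nMS M) +
  nat * 'I_(nBS M))%type.

Definition exo_events (i : exo_index) : set (set T) :=
  match i with
  | inl (inl (t, k, b)) => events_of (fad X t k b)
  | inl (inr (t, k)) => events_of (AQ X t k)
  | inr (t, b) => events_of (AE X t b)
  end.

Definition exo_time (i : exo_index) : nat :=
  match i with
  | inl (inl (t, _, _)) => t | inl (inr (t, _)) => t | inr (t, _) => t
  end.

Definition exo_idx (t : nat) : seq exo_index :=
  [seq inl (inl (t, kb.1, kb.2)) | kb <- index_enum ('I_(nMS M) * 'I_(nBS M))%type] ++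
  [seq inl (inr (t, k)) | k <- index_enum 'I_(nMS M)] ++
  [seq inr (t, b) | b <- index_enum 'I_(nBS M)].

Definition cap (N n : nat) : 'I_N.+1 := inord (minn n N).

Definition exo_atom (y : obs M) (i : exo_index) : set T :=
  match i with
  | inl (inl (t, k, b)) => fad X t k b @^-1` [set y.1.1 (k, b)]
  | inl (inr (t, k)) => AQ X t k @^-1` (cap (NQ M) @^-1` [set y.1.2 k])
  | inr (t, b) => AE X t b @^-1` (cap (NE M) @^-1` [set y.2 b])
  end.

Definition obs_at t w : obs M :=
  ([ffun kb => fad X t kb.1 kb.2 w], [ffun k => cap (NQ M) (AQ X t k w)],
   [ffun b => cap (NE M) (AE X t b w)]).

Lemma obs_at_dmeasurable t : dmeasurable (obs_at t).
Proof.
apply: dmeasurable_pair; first apply: dmeasurable_pair.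
- by apply: dmeasurable_ffun => kb; exact: fad_dmeasurable.
- by apply: dmeasurable_ffun => k; exact/dmeasurable_comp/AQ_dmeasurable.
- by apply: dmeasurable_ffun => b; exact/dmeasurable_comp/AE_dmeasurable.
Qed.

Lemma exo_events_measurable i A : exo_events i A -> measurable A.
Proof.
move: i => [[[[t k] b]|[t k]]|[t b]] [B _ <-].
- exact: fad_dmeasurable.
- exact: AQ_dmeasurable.
- exact: AE_dmeasurable.
Qed.

Lemma exo_atom_event y i : exo_events i (exo_atom y i).
Proof.
by move: i => [[[[t k] b]|[t k]]|[t b]]; eexists.
Qed.

Lemma exo_idx_uniq t : uniq (exo_idx t).
Proof.
rewrite !cat_uniq !map_inj_uniq ?index_enum_uniq/=.
- rewrite andbT; apply/andP; split.
    apply/hasPn => i; rewrite mem_cat => /orP[] /mapP[j _ ->]; apply/negP => /mapP[] //.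
  by apply/hasPn => i /mapP[j _ ->]; apply/negP => /mapP[].
- by move=> b b' [].
- by move=> k k' [].
- by move=> [k b] [k' b'] /= [-> ->].
Qed.

Lemma exo_idx_time t i : i \in exo_idx t -> exo_time i = t.
Proof. by rewrite !mem_cat => /or3P[] /mapP[j _ ->]. Qed.

Lemma obs_at_atom t y :
  obs_at t @^-1` [set y] = \big[setI/setT]_(i <- exo_idx t) exo_atom y i.
Proof.
apply/seteqP; split=> w.
  move=> /= e; apply/bigsetIP => i; rewrite !mem_cat => /or3P[] /mapP[j _ ->] /=.
  - by rewrite -e /= ffunE.
  - by rewrite -e /= ffunE.
  - by rewrite -e /= ffunE.
move/bigsetIP => h /=; case: y h => -[y1 y2] y3 h.
congr (_, _, _); apply/ffunP => j; rewrite ffunE.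
- have := h (inl (inl (t, j.1, j.2))); rewrite !mem_cat map_f ?mem_index_enum//.
  by move=> /(_ isT) /=; rewrite -surjective_pairing.
- have := h (inl (inr (t, j)));
  rewrite !mem_cat (map_f (fun k => inl (inr (t, k)))) ?mem_index_enum//.
  by rewrite orbT => /(_ isT).
- have := h (inr (t, j)); rewrite !mem_cat (map_f (fun b => inr (t, b))) ?mem_index_enum//.
  by rewrite !orbT => /(_ isT).
Qed.

Definition obs_law (y : obs M) : R := prob P (obs_at 0 @^-1` [set y]).

Lemma prob_obs_at t y : prob P (obs_at t @^-1` [set y]) =
  \prod_(i <- exo_idx t) prob P (exo_atom y i).
Proof.
rewrite obs_at_atom (indep_prob (@exo_indep _ _ _ _ _ X) exo_events_measurable (exo_idx_uniq t))//.
by move=> i _; exact: exo_atom_event.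
Qed.

(** By independence an atom's probability is a product over elementary variables, and each factor is
    the same in every slot. *)
Lemma obs_at_law t y : prob P (obs_at t @^-1` [set y]) = obs_law y.
Proof.
rewrite /obs_law !prob_obs_at !big_cat !big_map /=; congr (_ * (_ * _)).
- by apply: eq_bigr => kb _; rewrite /prob fad_ident.
- apply: eq_bigr => k _; apply: prob_nat_law; [exact: AQ_dmeasurable..|].
  exact: AQ_ident.
- apply: eq_bigr => b _; apply: prob_nat_law; [exact: AE_dmeasurable..|].
  exact: AE_ident.
Qed.

Lemma obs_law_ge0 y : 0 <= obs_law y. Proof. exact: prob_ge0. Qed.

Lemma obs_law_sum1 : \sum_y obs_law y = 1.
Proof. exact: prob_sum1 (obs_at_dmeasurable 0). Qed.

(* Arrivals have mean less than 1, so with positive probability MS [k] is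
   served in a slot without data arrivals. *)
Lemma serving_observation k : exists (p : bs_act M) (s : ms_act M) (y : obs M),
  [/\ good_act (p, [ffun=> s]), 0 < obs_law y,
      forall k', y.1.2 k' = 0%N :> nat &
      threshold k <= sinr (obs_channel y) p s k].
Proof.
have [H [p [s [pP sS adm]]]] := servable X k.
set ev := [set w | _] => evP.
have mF : dmeasurable (fun w => [ffun kb => fad X 0 kb.1 kb.2 w]).
  by apply: dmeasurable_ffun => kb; exact: fad_dmeasurable.
pose chan (f : {ffun 'I_(nMS M) * 'I_(nBS M) -> fval M}) : channel M :=
  fun k b => ssval (f (k, b)).
have chanE w : chan [ffun kb => fad X 0 kb.1 kb.2 w] = fun k' b => ssval (fad X 0 k' b w).
  by apply/funext => k'; apply/funext => b; rewrite /chan ffunE.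
have mev : measurable ev.
  have -> : ev = (fun w => [ffun kb => fad X 0 kb.1 kb.2 w]) @^-1`
      [set f : {ffun 'I_(nMS M) * 'I_(nBS M) -> fval M} | (forall k', f (k', assoc k') = H k') /\ threshold k <= sinr (chan f) p s k].
    apply/seteqP; split=> w /=; rewrite chanE => -[h1 h2]; split=> // k'.
      by rewrite ffunE h1.
    by have := h1 k'; rewrite ffunE.
  exact: mF.
have : prob P ev != 0.
  by rewrite gt_eqF// -lte_fin -probE.
(* The event depends on the fading only, so some joint fading value [f] of positive probability
   realizes it. *)
rewrite (prob_total P mF mev) psumr_neq0; last by move=> f _; exact: prob_ge0.
case/hasP => f _ /=.
set evf := ev `&` _ => evf0.
have mevf : measurable evf by apply: measurableI => //; exact: mF.
have [w [[_ w1] /= w2]] : evf !=set0.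
  by apply/set0P/eqP => e; move: evf0; rewrite e /prob measure0 /= ltxx.
have fad0 kb : 0 < prob P (fad X 0 kb.1 kb.2 @^-1` [set f kb]).
  apply: (lt_le_trans evf0); rewrite -lee_fin -!probE//; last exact: fad_dmeasurable.
  apply: le_measure; rewrite ?inE//; first exact: fad_dmeasurable.
  by move=> v [_ /= <-]; rewrite ffunE.
have AE0 b : exists n : 'I_(NE M).+1, 0 < prob P (AE X 0 b @^-1` (cap (NE M) @^-1` [set n])).
  have mc : dmeasurable (fun w => cap (NE M) (AE X 0 b w)).
    exact/dmeasurable_comp/AE_dmeasurable.
  have : \sum_v prob P ((fun w => cap (NE M) (AE X 0 b w)) @^-1` [set v]) != 0.
    by rewrite prob_sum1// oner_eq0.
  rewrite psumr_neq0; last by move=> v _; exact: prob_ge0.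
  by case/hasP => n _ /= n0; exists n.
have [n hn] := choice AE0.
(* A serving fading value, no data arrivals, and any energy arrivals of positive probability; by
   independence the law of [y] is a product of positive factors. *)
pose y : obs M := (f, [ffun=> ord0], [ffun b => n b]).
exists p, s, y; split.
- by apply/good_actP; split=> // H'; rewrite ffunE.
- rewrite /obs_law prob_obs_at !big_cat !big_map /=.
  rewrite !mulr_gt0 ?prodr_gt0// => [kb _|k' _|b _]; last 2 first.
  + have := prob0_gt0 (AQ_dmeasurable X 0 k') (AQ_mean X 0 k') (lamQ_lt1 X k').
    move=> h; apply: (lt_le_trans h); rewrite -lee_fin -!probE; try exact: AQ_dmeasurable.
    apply: le_measure; rewrite ?inE; try exact: AQ_dmeasurable.
    move=> v /= v0; rewrite ffunE /cap v0 min0n; apply/val_inj; by rewrite /= inordK.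
  + by rewrite ffunE; exact: hn.
  + by rewrite -surjective_pairing; exact: fad0.
- by move=> k'; rewrite ffunE.
- have -> : obs_channel y = fun k' b => ssval (fad X 0 k' b w).
    by rewrite -chanE w2.
  exact: w1.
Qed.

(** The reachability hypothesis of the decision process: without arrivals no queue grows, and the
    served nonempty one shrinks. *)
Lemma serving_reach (x : pstate M) : (0 < \sum_k x.2 k)%N ->
  exists b y, [/\ good_act b, 0 < obs_law y &
    (\sum_k (greedy_slot x b y).2 k < \sum_k x.2 k)%N].
Proof.
move=> x0.
have [k xk] : exists k, (0 < x.2 k)%N.
  apply: contrapT => /forallNP h; move: x0; rewrite big1// => k _.
  by apply/eqP; rewrite -leqn0 leqNgt; apply/negP/h.
have [p [s [y [gb y0 ya sv]]]] := serving_observation k.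
exists (p, [ffun=> s]), y; split=> //.
have upd k' := greedy_slot_queue x (p, [ffun=> s]) y k'.
have le1 k' : ((greedy_slot x (p, [ffun=> s]) y).2 k' <= x.2 k')%N.
  rewrite upd ya addn0; apply: leq_trans (geq_minl _ _) _; exact: leq_subr.
rewrite [ltnLHS](bigD1 k)//= [ltnRHS](bigD1 k)//= -addSn.
apply: leq_add; last by apply: leq_sum => k' _; exact: le1.
by apply: (ltn_update (upd k) _ (ya k) xk); rewrite /= ffunE.
Qed.

End Exogenous.

(** * Policies as Markov chains *)

Section Sequences.
Context {R : realType}.

(** The defects [e t] vanish from [n0] on, so the initial slots contribute only a constant to the
    partial sums. *)
Lemma telescoping_bounded (a v : nat -> R) (l k : R) (n0 : nat) :
  (forall t, (n0 <= t)%N -> a t = l + v t - v t.+1) -> (forall t, `|v t| <= k) ->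
  exists C, forall n, `|\sum_(t < n) a t - n%:R * l| <= C.
Proof.
move=> aE vk; pose e t := a t - l - (v t - v t.+1).
have e0 t : (n0 <= t)%N -> e t = 0 by move=> /aE; rewrite /e => ->; ring.
exists (\sum_(t < n0) `|e t| + 2 * k) => n.
have -> : \sum_(t < n) a t - n%:R * l = \sum_(t < n) e t + (v 0%N - v n).
  elim: n => [|n IH]; first by rewrite !big_ord0; ring.
  rewrite !big_ord_recr /= -natr1; move: IH; rewrite /e => /eqP; rewrite subr_eq => /eqP ->.
  ring.
have le1 : `|\sum_(t < n) e t| <= \sum_(t < n0) `|e t|.
  apply: (le_trans (ler_norm_sum _ _ _)).
  elim: n => [|n IH]; first by rewrite big_ord0 sumr_ge0.
  have [n0n|nn0] := leqP n0 n.
    by rewrite big_ord_recr /= (e0 n)// normr0 addr0.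
  rewrite -!(big_mkord predT (fun t => `|e t|)) (@big_cat_nat _ _ _ n.+1 0 n0)//=.
  by rewrite lerDl sumr_ge0.
apply: (le_trans (ler_normD _ _)); apply: lerD => //.
apply: (le_trans (ler_normB _ _)); have := vk 0%N; have := vk n; lra.
Qed.

(** With [a * m t.+1 = m t.+1 - (1 - a) * m t.+1] and [(1 - a) * m t.+1 >= g - e], the inequality
    telescopes. *)
Lemma discounted_sum_ge (b m : nat -> R) (a g k e : R) : a < 1 ->
  (forall t, (0 < t)%N -> m t <= b t + a * m t.+1) ->
  (forall t, `|m t - g / (1 - a)| <= k) -> (1 - a) * k <= e ->
  exists C, forall n, n%:R * (g - e) - C <= \sum_(t < n) b t.
Proof.
move=> a1 mb mk ke; have a1' : 0 < 1 - a by rewrite subr_gt0.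
have gE : (1 - a) * (g / (1 - a)) = g by rewrite mulrC divfK// gt_eqF.
have mk' t : g / (1 - a) - k <= m t <= g / (1 - a) + k.
  by have := mk t; rewrite ler_norml; lra.
have bge t : (0 < t)%N -> m t - m t.+1 + (g - e) <= b t.
  by move=> /mb; have /andP[] := mk' t.+1; nra.
(* The constant pays for slot 0, where the inequality is not assumed, for the term [g - e] missing
   there, and for the telescoped difference of two values of [m]. *)
exists (`|b 0%N| + `|g - e| + 2 * k) => -[|n].
  have : 0 <= k by apply: le_trans (mk 0%N).
  by rewrite mul0r big_ord0 sub0r oppr_le0 => k0; rewrite !addr_ge0// mulr_ge0.
have h : b 0%N + n%:R * (g - e) + (m 1%N - m n.+1) <= \sum_(t < n.+1) b t.
  elim: n => [|n IH]; first by rewrite big_ord_recl big_ord0 /= mul0r subrr !addr0.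
  rewrite big_ord_recr /= -natr1; have := bge n.+1 isT; lra.
have /andP[] := mk' 1%N; have /andP[] := mk' n.+1.
have := ler_norm (- b 0%N); have := ler_norm (g - e); rewrite normrN -natr1; lra.
Qed.

(** It suffices to look at one large horizon [n] at which every component average is at most
    [l i + e]. *)
Lemma weighted_limsup_ge (I : finType) (w : I -> R) (a : I -> nat -> R) (B g : R) :
  (forall i, 0 < w i) -> (forall i t, `|a i t| <= B) ->
  (forall e, 0 < e -> exists C, forall n : nat,
     n%:R * (g - e) - C <= \sum_(t < n) \sum_i w i * a i t) ->
  (g%:E <= \sum_i (w i)%:E * limn_esup (fun n => (n%:R^-1 * \sum_(t < n) a i t)%:E))%E.
Proof.
move=> w0 aB hg.
have avgB i n : `|n%:R^-1 * \sum_(t < n) a i t| <= B.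
  case: n => [|n]; first by rewrite big_ord0 mulr0 normr0; apply: le_trans (aB i 0%N).
  rewrite normrM ger0_norm ?invr_ge0// mulrC ler_pdivrMr ?ltr0n//.
  apply: (le_trans (ler_norm_sum _ _ _)).
  apply: (le_trans (ler_sum _ (fun (t : 'I_n.+1) _ => aB i t))).
  by rewrite sumr_const card_ord mulr_natr.
have /choice[l hl] := fun i => limn_esup_bounded (avgB i).
under eq_bigr do rewrite (hl _).1 -EFinM.
rewrite sumEFin lee_fin; apply/ler_addgt0Pr => e' e'0.
pose W := \sum_i w i.
have W0 : 0 <= W by apply: sumr_ge0 => i _; exact: ltW.
(* The slack [e] is spent with total weight [W] on the averages, once on [g - e] and once on
   [C / n]. *)
pose e := e' / (W + 2).
have e0 : 0 < e by rewrite divr_gt0//; lra.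
have eE : e * (W + 2) = e' by rewrite /e divfK// gt_eqF//; lra.
have [C hC] := hg e e0.
have /choice[N hN] : forall i, exists N, forall n, (N <= n)%N ->
    n%:R^-1 * \sum_(t < n) a i t <= l i + e.
  by move=> i; exact: (hl i).2.
pose n := (\max_i N i + (Num.truncn (C / e)).+1)%N.
have n0 : 0 < n%:R :> R by rewrite ltr0n /n addnS.
have Cn : C <= n%:R * e.
  rewrite -ler_pdivrMr//; apply: (le_trans (ltW (truncnS_gt _))).
  by rewrite ler_nat /n leq_addl.
have upper : \sum_(t < n) \sum_i w i * a i t <= n%:R * (\sum_i w i * l i + e * W).
  have -> : \sum_i w i * l i + e * W = \sum_i w i * (l i + e).
    by rewrite mulr_sumr -big_split; apply: eq_bigr => i _ /=; ring.
  rewrite exchange_big /= mulr_sumr; apply: ler_sum => i _; rewrite -mulr_sumr mulrCA.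
  rewrite ler_pM2l//; have := hN i n (leq_trans (leq_bigmax i) (leq_addr _ _)).
  by rewrite mulrC ler_pdivrMr// mulrC.
have := le_trans (hC n) upper => h.
have : n%:R * (g - e) <= n%:R * (\sum_i w i * l i + e * W + e) by rewrite mulrDr; lra.
rewrite ler_pM2l//; lra.
Qed.

End Sequences.

Section PolicyChain.
Context {R : realType} {M : network R} {d : measure_display}
  {T : measurableType d} {P : probability T R} (X : exogenous M P)
  (chi1 : state M) (pi : policy M).

(** In slot 0 the given CSI overrides the observed fading from the own BS; [chain_step] therefore
    agrees with [slot] from slot 1 on. *)
Definition fad_of_obs t (y : obs M) k b : fval M :=
  if (t == 0%N) && (b == assoc k) then st_H chi1 k else y.1.1 (k, b).

Definition chain_step t (s : pstate M) (y : obs M) : pstate M :=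
  (next_energy s.1 (renew pi t s.1 s.2) (fun b => y.2 b),
   next_queues s.2 (fun k b => ssval (fad_of_obs t y k b))
     (dtx (renew pi t s.1 s.2) (grid pi t s.1 s.2))
     (sched pi t s.1 s.2 [ffun k => fad_of_obs t y k (assoc k)]) (fun k => y.1.2 k)).

Lemma chain_step_slot t s y : chain_step t.+1 s y =
  slot s (renew pi t.+1 s.1 s.2) (grid pi t.+1 s.1 s.2) (sched pi t.+1 s.1 s.2) y.
Proof. reflexivity. Qed.

Lemma next_energy_cap (e : energy M) pE a :
  next_energy e pE (fun b => cap (NE M) (a b)) = next_energy e pE a.
Proof.
apply/ffunP => b; apply: val_inj; rewrite /= !next_energyE /cap inordK ?ltnS ?geq_minr//.
lia.
Qed.

Lemma next_queues_cap (q : queues M) h p s a :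
  next_queues q h p s (fun k => cap (NQ M) (a k)) = next_queues q h p s a.
Proof.
apply/ffunP => k; apply: val_inj; rewrite /= !next_queuesE /cap inordK ?ltnS ?geq_minr//.
by case: (_ <= _)%R; lia.
Qed.

Lemma fad_of_obs_at t w : fad_of_obs t (obs_at X t w) = fad_at X chi1 t w.
Proof.
by apply/funext => k; apply/funext => b; rewrite /fad_of_obs /fad_at ffunE.
Qed.

Lemma policy_traj_step t w :
  policy_traj X chi1 pi t.+1 w = chain_step t (policy_traj X chi1 pi t w) (obs_at X t w).
Proof.
rewrite [LHS]/= /step /chain_step; move: (policy_traj X chi1 pi t w) => s.
rewrite fad_of_obs_at -next_energy_cap -next_queues_cap; congr (_, _).
  by congr next_energy; apply/funext => b; rewrite ffunE.
by congr next_queues; apply/funext => k; rewrite ffunE.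
Qed.

Definition state_law t (s : pstate M) : R := prob P (policy_traj X chi1 pi t @^-1` [set s]).

Lemma policy_traj_dmeasurable t : dmeasurable (policy_traj X chi1 pi t).
Proof.
exact: (state_dmeasurable (obs_at_dmeasurable X)
  (s0 := (st_E chi1, st_Q chi1)) (fun=> erefl) policy_traj_step).
Qed.

Lemma state_law_ge0 t s : 0 <= state_law t s. Proof. exact: prob_ge0. Qed.

Lemma state_law_sum1 t : \sum_s state_law t s = 1.
Proof. exact: prob_sum1 (policy_traj_dmeasurable t). Qed.

Lemma mean_state_law_step t (f : pstate M -> R) :
  mean (state_law t.+1) f =
  mean (state_law t) (fun s => mean (obs_law X) (fun y => f (chain_step t s y))).
Proof.
have := mean_state_step (x := policy_traj X chi1 pi) (s0 := (st_E chi1, st_Q chi1))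
  (@exo_indep _ _ _ _ _ X) (exo_events_measurable (X := X))
  (exo_idx_uniq (M := M)) (exo_idx_time (M := M)) (fun t y i _ => exo_atom_event X y i)
  (obs_at_atom X) (obs_at_dmeasurable X) (fun=> erefl) policy_traj_step t f.
move=> e; apply: (etrans e); apply: eq_mean => s.
by apply: eq_bigr => y _; rewrite obs_at_law.
Qed.

Definition slot_cost (i : 'I_(nMS M) + 'I_(nBS M)) t : R :=
  mean (state_law t) (fun s => cost_part i s (grid pi t s.1 s.2)).

Lemma slot_cost_bounded : exists B, forall i t, `|slot_cost i t| <= B.
Proof.
exists (\sum_(n < (NQ M).+1) `|cost M n| + 1) => i t.
apply: mean_norm_le; [exact: state_law_ge0|exact: state_law_sum1|] => s.
case: i => [k|b] /=.
  by rewrite (bigD1 (s.2 k))//= -addrA lerDl addr_ge0// sumr_ge0.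
by rewrite normr_nat; case: (grid _ _ _ _ _); rewrite /= ?lerDr ?addr_ge0 ?sumr_ge0.
Qed.

Lemma closed_loop_traj t w : traj X chi1 (closed_loop X chi1 pi) t w = policy_traj X chi1 pi t w.
Proof. by elim: t => //= t ->. Qed.

Lemma limsup_avg_slot_cost i :
  @limsup_avg R d T P (fun t w => cost_part i (policy_traj X chi1 pi t w)
    (grid pi t (policy_traj X chi1 pi t w).1 (policy_traj X chi1 pi t w).2)) =
  limn_esup (fun n => (n%:R^-1 * \sum_(t < n) slot_cost i t)%:E).
Proof.
congr limn_esup; apply/funext => n; rewrite EFinM; congr (_ * _)%E.
exact: (integral_finite_sum P (fun t s => cost_part i s (grid pi t s.1 s.2)) n
  policy_traj_dmeasurable).
Qed.

Lemma J_slot_cost : J X chi1 pi = (\sum_i (cost_weight i)%:E *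
  limn_esup (fun n => (n%:R^-1 * \sum_(t < n) slot_cost i t)%:E))%E.
Proof.
rewrite big_sumType; congr (_ + _)%E; apply: eq_bigr => j _.
  rewrite -(limsup_avg_slot_cost (inl j)).
  apply: (congr1 (fun z => ((beta j)%:E * @limsup_avg R d T P z)%E)).
  apply/funext => t; apply/funext => w.
  exact (congr1 (fun x : pstate M => cost M (x.2 j)) (closed_loop_traj t w)).
rewrite -(limsup_avg_slot_cost (inr j)); reflexivity.
Qed.

Lemma cost_weight_gt0 i : 0 < cost_weight (M := M) i.
Proof. by case: i => [k|b]; [exact: beta_gt0|exact: gamma_gt0]. Qed.

(** Averaging [optimal_value_bellman] over the state law gives a discounted recursion for the mean
    of [V] along any feasible policy, and closeness of [V] to [g / (1 - a)] turns it into an average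
    cost of at least [g - e]. *)
Lemma policy_cost_ge (sigma : pstate M -> act M) (g : R) : feasible pi ->
  (forall e : R, 0 < e -> exists (a : R) (V : pstate M -> R) (k : R),
    [/\ 0 <= a, a < 1,
        discount_optimal (obs_law X) (greedy_slot (M := M)) (good_act (M := M))
          (fun x b => \sum_i cost_weight i * greedy_cost i x b) a sigma V,
        (1 - a) * k <= e &
        forall x, `|V x - g / (1 - a)| <= k]) ->
  (g%:E <= J X chi1 pi)%E.
Proof.
move=> feas near; rewrite J_slot_cost.
have [B aB] := slot_cost_bounded.
apply: (weighted_limsup_ge (B := B)) => //; first exact: cost_weight_gt0.
move=> e /near[a [V [k [a0 a1 opt ke Vk]]]].
pose m t := mean (state_law t) V.
have mb t : (0 < t)%N -> m t <= \sum_i cost_weight i * slot_cost i t + a * m t.+1.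
  case: t => // t _.
  have -> : \sum_i cost_weight i * slot_cost i t.+1 = mean (state_law t.+1)
      (fun s => \sum_i cost_weight i * cost_part i s (grid pi t.+1 s.1 s.2)).
    rewrite /mean; under [RHS]eq_bigr do rewrite mulr_sumr.
    rewrite exchange_big; apply: eq_bigr => i _; rewrite mulr_sumr.
    by apply: eq_bigr => s _; rewrite mulrCA.
  rewrite /m (mean_state_law_step t.+1) -meanZ -meanD.
  apply: le_mean => [s|s]; first exact: state_law_ge0.
  (* [st_H chi1] serves as a witness that a CSI exists. *)
  exact (optimal_value_bellman (obs_law_ge0 X) (obs_law_sum1 X) a0 a1 opt (st_H chi1)
    (fun H => feas t.+1 s.1 s.2 H)).
have mk t : `|m t - g / (1 - a)| <= k.
  have -> : m t - g / (1 - a) = mean (state_law t) (fun s => V s - g / (1 - a)).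
    by rewrite meanB mean_cst//; exact: state_law_sum1.
  by apply: mean_norm_le => //; [exact: state_law_ge0|exact: state_law_sum1].
exact: discounted_sum_ge a1 mb mk ke.
Qed.

(** From [n0] on the mean of the harmonic [u i] is constant and the bias telescopes, so each
    component average converges to the mean of [u i] at [n0]. Whatever the state law at [n0], these
    limits have weighted sum [g]. *)
Lemma stationary_cost (sigma : pstate M -> act M) u v (g : R) n0 : (0 < n0)%N ->
  (forall t, (n0 <= t)%N -> forall s,
     [/\ renew pi t s.1 s.2 = renew_part s.1 (sigma s).1,
         grid pi t s.1 s.2 = grid_part s.1 (sigma s).1 &
         forall H, sched pi t s.1 s.2 H = (sigma s).2 H]) ->
  (forall i x, greedy_cost i x (sigma x) =
     u i x + v i x - mean (obs_law X) (v i \o greedy_slot x (sigma x))) ->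
  (forall i x, u i x = mean (obs_law X) (u i \o greedy_slot x (sigma x))) ->
  (forall x, \sum_i cost_weight i * u i x = g) ->
  J X chi1 pi = g%:E.
Proof.
move=> n00 piE cE uE gE; rewrite J_slot_cost.
have step t (f : pstate M -> R) : (n0 <= t)%N -> mean (state_law t.+1) f =
    mean (state_law t) (fun s => mean (obs_law X) (f \o greedy_slot s (sigma s))).
  move=> n0t; rewrite mean_state_law_step; apply: eq_mean => s; apply: eq_mean => y.
  case: t n0t => [|t] n0t; first by exfalso; rewrite leqNgt n00 in n0t.
  rewrite chain_step_slot /=; have [-> -> sE] := piE _ n0t s.
  by rewrite /greedy_slot /slot sE.
have uconst i t : (n0 <= t)%N -> mean (state_law t) (u i) = mean (state_law n0) (u i).
  elim: t => [|t IH]; first by rewrite leqn0 => /eqP ->.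
  rewrite leq_eqVlt => /orP[/eqP ->//|]; rewrite ltnS => n0t.
  by rewrite step// -IH//; apply: eq_mean => s; rewrite -uE.
have lim i : limn_esup (fun n => (n%:R^-1 * \sum_(t < n) slot_cost i t)%:E) =
    (mean (state_law n0) (u i))%:E.
  have [] := @telescoping_bounded R (slot_cost i) (fun t => mean (state_law t) (v i))
    (mean (state_law n0) (u i)) (\sum_s `|v i s|) n0.
  - move=> t n0t; rewrite -(uconst i t n0t) step// -meanD -meanB.
    apply: eq_mean => s; have [_ -> _] := piE t n0t s; exact: cE.
  - move=> t; apply: mean_norm_le; [exact: state_law_ge0|exact: state_law_sum1|] => s.
    by rewrite (bigD1 s)//= lerDl sumr_ge0.
  move=> C; exact: cesaro_limn_esup.
under eq_bigr do rewrite lim -EFinM.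
rewrite sumEFin; congr EFin; rewrite -[RHS](mean_cst (state_law_sum1 n0)).
rewrite /mean; under eq_bigr do rewrite mulr_sumr.
rewrite exchange_big; apply: eq_bigr => s _ /=; rewrite -(gE s) mulr_sumr.
by apply: eq_bigr => i _; rewrite mulrCA.
Qed.

End PolicyChain.

(** * The greedy policy that becomes stationary *)

Section GreedyPolicy.
Context {R : realType} {M : network R}.

(** The DTX mappings of [pi0] are copied through slot [n], one slot more than prescribed; the
    stationary phase starts at [n.+1], past slot 0 with its given CSI. *)
Definition greedy_policy (n : nat) (pi0 : policy M) (sigma : pstate M -> act M) : policy M :=
  let p t (e : energy M) (q : queues M) :=
    if (t <= n)%N then policy_dtx pi0 t e q else (sigma (e, q)).1 in
  Policy (fun t e q => renew_part e (p t e q)) (fun t e q => grid_part e (p t e q))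
    (fun t e q H => if (t <= n)%N then sched pi0 t e q H else (sigma (e, q)).2 H).

Lemma greedy_policy_dtx n pi0 sigma t e q : (t <= n)%N ->
  policy_dtx (greedy_policy n pi0 sigma) t e q = policy_dtx pi0 t e q.
Proof. by move=> tn; rewrite /policy_dtx /= dtx_parts tn. Qed.

Lemma greedy_policy_greedy n pi0 sigma : greedy (greedy_policy n pi0 sigma).
Proof. by move=> t e q; exact: greedy_parts. Qed.

Lemma feasible_greedy_policy (hP : forall p p' : bs_act M,
      p \in dtx_set M -> (forall b, p' b -> p b) -> p' \in dtx_set M)
    n pi0 sigma : feasible pi0 -> (forall x, good_act (sigma x)) ->
  feasible (greedy_policy n pi0 sigma).
Proof.
move=> feas0 good t e q H; apply: (feasible_parts hP) => /=; case: leqP => _.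
- by have [[]] := feas0 t e q H.
- by have /good_actP[] := good (e, q).
- by have [[]] := feas0 t e q H.
- by have /good_actP[_ /(_ H)[]] := good (e, q).
- by have [] := feas0 t e q H.
- by have /good_actP[_ /(_ H)[]] := good (e, q).
Qed.

End GreedyPolicy.

Theorem lemma1 (R : realType) (M : network R) (d : measure_display)
    (T : measurableType d) (P : probability T R) (X : exogenous M P)
    (hP : forall p p' : bs_act M,
        p \in dtx_set M -> (forall b, p' b -> p b) -> p' \in dtx_set M)
    (chi1 : state M) :
  (forall c0 : control, feasible_control X chi1 c0 ->
     exists c : control,
       [/\ feasible_control X chi1 c, same_dtx_sched c c0,
           greedy_control X chi1 c &
           forall c' : control, feasible_control X chi1 c' ->
             same_dtx_sched c' c0 ->
             (control_J X chi1 c <= control_J X chi1 c')%E])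
  /\
  (forall (n : nat) (pi0 : policy M), feasible pi0 ->
     exists pi : policy M,
       [/\ feasible pi,
           forall t, (t < n)%N -> forall e q,
             policy_dtx pi t e q = policy_dtx pi0 t e q,
           greedy pi &
           forall pi' : policy M, feasible pi' ->
             (forall t, (t < n)%N -> forall e q,
                policy_dtx pi' t e q = policy_dtx pi0 t e q) ->
             (J X chi1 pi <= J X chi1 pi')%E]).
Proof.
split=> [c0 feas0|n pi0 feas0].
  exists (greedify X chi1 c0); split.
  - exact: feasible_greedify.
  - by move=> t w; split; first exact: greedify_dtx.
  - exact: greedify_greedy.
  - by move=> c feas same; apply: greedify_optimal => //; exact: feasible_greedify.
pose x0 : pstate M := (st_E chi1, st_Q chi1).
(* [vanishing_discount] starts from one good action; slot 0 of [pi0] supplies it. *)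
pose b0 : act M := (policy_dtx pi0 0 x0.1 x0.2, finfun (sched pi0 0 x0.1 x0.2)).
have good0 : good_act b0.
  apply/good_actP; have feasH := feas0 0%N x0.1 x0.2; split=> [|H] /=.
    by have [[]] := feasH (st_H chi1).
  by rewrite ffunE; have [[_ _ _ ?] _ _ ?] := feasH H.
have rank0 a sigma V (a0 : 0 <= a) (a1 : a < 1)
    (opt : discount_optimal (obs_law X) (greedy_slot (M := M)) (good_act (M := M))
      (fun x b => \sum_i cost_weight i * greedy_cost i x b) a sigma V) :=
  optimal_value_rank0 (obs_law_ge0 X) (obs_law_sum1 X) a0 a1 opt.
have [sigma [u [v [g [sgood cE uE gE near]]]]] :=
  vanishing_discount (obs_law_ge0 X) (obs_law_sum1 X) (serving_reach X) x0 good0 rank0.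
have feasg := feasible_greedy_policy hP n feas0 sgood.
exists (greedy_policy n pi0 sigma); split.
- exact: feasg.
- by move=> t tn e q; exact/greedy_policy_dtx/ltnW.
- exact: greedy_policy_greedy.
move=> pi' feas' _.
rewrite (stationary_cost (n0 := n.+1) chi1 (ltn0Sn n) _ cE uE gE).
  exact: policy_cost_ge feas' near.
by move=> t nt [e q] /=; rewrite leqNgt nt.
Qed.
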